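(* Let $\Delta=\{z\in\mathbb{C}:|z|<1\}$ and let $\varphi$ be a radial subharmonic function on $\Delta$ with $\varphi(0)=0$, written as $\varphi(z)=u(\log|z|^2)$ with $u$ convex and increasing on $\mathbb{R}_{<0}$. (a) Suppose $u$ is strictly increasing and $\lim_{t\to 0^-}u(t)=+\infty$. Put $\psi(w):=-u^{-1}(-\log|w|^2)$ for $0<|w|<1$ and $\psi(0):=0$, and let $\widetilde{\Delta}:=\{(z,w)\in\mathbb{C}^2:z\in\Delta,\ |w|^2<e^{-\varphi(z)}\}$. Then $\widetilde{G}(z,w):=\log|z|^2+\psi(w)$ is a negative plurisubharmonic function on $\widetilde{\Delta}$, $\psi$ is continuous on $\{|w|<1\}$ (so that $\log|z|^2+\widetilde{A}\geq\widetilde{G}\geq\log|z|^2-\widetilde{B}$ holds on $\widetilde{\Delta}$ with the continuous functions $\widetilde{A}(z,w)=\psi(w)$ and $\widetilde{B}(z,w)=-\psi(w)$), and $$\int_{|w|<1}e^{\widetilde{B}(0,w)}\,d\lambda(w)=\min\left\{\int_\Delta|f|^2e^{-\varphi}\,d\lambda : f\in\mathcal{O}(\Delta),\ f(0)=1\right\},$$ the minimum being attained by the constant function $f\equiv 1$. (b) For general radial $\varphi$ as in the first sentence and $\epsilon>0$, let $\varphi_\epsilon(z):=\varphi(z)-\epsilon\log(1-|z|^2)$. Then $\varphi_\epsilon$ satisfies the assumptions of (a), and, with $\psi_\epsilon$ denoting the function associated with $\varphi_\epsilon$ in the same way as $\psi$ is associated with $\varphi$ in (a), $$\lim_{\epsilon\downarrow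 0}\int_{|w|<1}e^{-\psi_\epsilon(w)}\,d\lambda(w)=\min\left\{\int_\Delta|f|^2e^{-\varphi}\,d\lambda : f\in\mathcal{O}(\Delta),\ f(0)=1\right\}=\int_\Delta e^{-\varphi}\,d\lambda.$$
   Context: $d\lambda$ denotes Lebesgue measure on $\mathbb{C}$, and $\mathcal{O}(\Delta)$ the space of holomorphic functions on $\Delta$. Radial means that the function depends only on $|z|$. The condition $\varphi(0)=0$ means $\lim_{t\to-\infty}u(t)=0$, so in (a) $u:\mathbb{R}_{<0}\to\mathbb{R}_{>0}$ is a bijection. The quantity $\int_{|w|<1}e^{\widetilde{B}(0,w)}\,d\lambda(w)$ is an upper bound for the weighted $L^2$-norm squared of some holomorphic extension $f$ with $f(0)=1$ (an Ohsawa–Takegoshi type estimate); the claim is that for radial weights this bound is the least possible one. *)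

(* Defs.v *)
From HB Require Import structures.
From mathcomp Require Import all_boot all_order all_algebra.
From mathcomp Require Import all_classical all_reals all_analysis.
From mathcomp Require Import complex.
Import numFieldNormedType.Exports.
Import Order.TTheory GRing.Theory Num.Theory.
Import Normc.

Set Implicit Arguments.
Unset Strict Implicit.
Unset Printing Implicit Defensive.

Local Open Scope classical_set_scope.
Local Open Scope ring_scope.

(* [^o] provides the normed-module structure (topology, [derivable]) of R[i]
   over itself; products then carry the product topology. *)
Notation Cplx R := ((complex R)^o).

Definition unit_disc (R : realType) : set (Cplx R) := [set z | normc z < 1].
Arguments unit_disc R : clear implicits.

(* The integral of h over D against Lebesgue measure of C = R x R. *)
Definition area_int (R : realType) (D : set (Cplx R)) (h : Cplx R -> R)
    : \bar R :=
  (\int[(@lebesgue_measure R) \x (@lebesgue_measure R)]_(p in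
      [set p : R * R | D (p.1 +i* p.2)%C]) (h (p.1 +i* p.2)%C)%:E)%E.

(* Since D is open in all uses, complex differentiability at every point. *)
Definition holomorphic_on (R : realType) (D : set (Cplx R))
    (f : Cplx R -> Cplx R) : Prop :=
  forall z, D z -> derivable f z 1.

(* Upper semicontinuity of g : Omega -> [-oo, +oo[ on an open set Omega. *)
Definition usc_on (R : realType) (X : topologicalType) (Omega : set X)
    (g : X -> \bar R) : Prop :=
  forall x, Omega x -> (g x < +oo)%E /\
    forall c : R, (g x < c%:E)%E -> \forall y \near x, (g y < c%:E)%E.

Definition circle_int (R : realType) (g : Cplx R -> \bar R) (a : Cplx R)
    (r : R) : \bar R :=
  (\int[@lebesgue_measure R]_(t in [set` `[0%R, (2 * pi)%R]])
    g (a + r%:C%C * (cos t +i* sin t)%C)%R)%E.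

(* Upper semicontinuous with the sub-mean value inequality on every closed disc
   contained in D. As is usual with this definition, the function identically
   -oo is allowed: the slice of log |z|^2 + psi (w) along z = 0 is of that
   kind. By upper semicontinuity the integrand is bounded above, so that the
   integral is a well-defined element of [-oo, +oo[. *)
Definition subharmonic (R : realType) (D : set (Cplx R))
    (g : Cplx R -> \bar R) : Prop :=
  [/\ open D, usc_on D g &
    forall (a : Cplx R) (r : R), 0 < r ->
      (forall z : Cplx R, normc (z - a) <= r -> D z) ->
      (g a <= ((2 * pi)^-1)%:E * circle_int g a r)%E].

Definition plurisubharmonic (R : realType) (Omega : set (Cplx R * Cplx R))
    (g : Cplx R * Cplx R -> \bar R) : Prop :=
  [/\ open Omega, usc_on Omega g &
    forall a b : Cplx R * Cplx R,
      subharmonic [set s : Cplx R | Omega (a + s *: b)]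
                  (fun s => g (a + s *: b))].

Definition radial_on (R : realType) (D : set (Cplx R)) (phi : Cplx R -> R)
    : Prop :=
  forall z w, D z -> D w -> normc z = normc w -> phi z = phi w.

(* phi is a radial subharmonic function on the unit disc with phi 0 = 0, and
   phi z = u (log |z|^2) with u convex and nondecreasing on ]-oo, 0[. Since
   phi is given by the real-valued u off 0 and by phi 0 = 0, it is taken
   real-valued; lim_(t -> -oo) u t = 0 follows from subharmonicity. *)
Definition radial_weight (R : realType) (phi : Cplx R -> R) (u : R -> R)
    : Prop :=
  [/\ subharmonic (unit_disc R) (EFin \o phi),
      radial_on (unit_disc R) phi,
      phi 0 = 0,
      (@convex_function R R^o `]-oo, 0[%classic u /\
       {in `]-oo, 0[ &, {homo u : s t / s <= t}}) &
      forall z, 0 < normc z < 1 -> phi z = u (ln (normc z ^+ 2))].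

Definition exhaustive_weight (R : realType) (phi : Cplx R -> R) (u : R -> R)
    : Prop :=
  [/\ radial_weight phi u,
      {in `]-oo, 0[ &, {homo u : s t / s < t}} &
      u t @[t --> 0^'-] --> +oo].

(* 'pinv_ d A u s is a point of A sent by u to s, whenever s \in u @` A; the
   value of psi is only meaningful for |w| < 1. *)
Definition psi (R : realType) (u : R -> R) (w : Cplx R) : R :=
  if w == 0 then 0
  else - ('pinv_(fun=> 0) `]-oo, 0[%classic u (- ln (normc w ^+ 2))).

Definition tDelta (R : realType) (phi : Cplx R -> R)
    : set (Cplx R * Cplx R) :=
  [set p | unit_disc R p.1 /\ normc p.2 ^+ 2 < expR (- phi p.1)].

(* [lne] has value -oo at 0. *)
Definition log_sq (R : realType) (z : Cplx R) : \bar R :=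
  lne (normc z ^+ 2)%:E.

Definition tG (R : realType) (u : R -> R) (p : Cplx R * Cplx R) : \bar R :=
  (log_sq p.1 + (psi u p.2)%:E)%E.

Definition tA (R : realType) (u : R -> R) (p : Cplx R * Cplx R) : R :=
  psi u p.2.

Definition tB (R : realType) (u : R -> R) (p : Cplx R * Cplx R) : R :=
  - psi u p.2.

Definition extensions (R : realType) : set (Cplx R -> Cplx R) :=
  [set f | holomorphic_on (unit_disc R) f /\ f 0 = 1].
Arguments extensions R : clear implicits.

(* May be +oo. *)
Definition wnorm2 (R : realType) (phi : Cplx R -> R) (f : Cplx R -> Cplx R)
    : \bar R :=
  area_int (unit_disc R) (fun z => normc (f z) ^+ 2 * expR (- phi z)).

Definition is_min (R : realType) (S : set (\bar R)) (m : \bar R) : Prop :=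
  S m /\ lbound S m.

Definition phi_eps (R : realType) (phi : Cplx R -> R) (e : R) (z : Cplx R)
    : R :=
  phi z - e * ln (1 - normc z ^+ 2).

(* The profile of phi_eps: phi_eps z = u_eps (log |z|^2). *)
Definition u_eps (R : realType) (u : R -> R) (e : R) (t : R) : R :=
  u t - e * ln (1 - expR t).

(* Main.v *)
Require Import Defs.
From HB Require Import structures.
From mathcomp Require Import all_boot all_order all_algebra.
From mathcomp Require Import all_classical all_reals all_analysis.
From mathcomp Require Import measurable_realfun.
From mathcomp Require Import complex.
From mathcomp Require Import ring lra.
Import numFieldNormedType.Exports.
Import Order.TTheory GRing.Theory Num.Theory.
Import Normc.

Set Implicit Arguments.
Unset Strict Implicit.
Unset Printing Implicit Defensive.

Local Open Scope classical_set_scope.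
Local Open Scope ring_scope.

(** The minimal norm and the integral of exp(-psi) are both equal to the
integral of exp(-phi) over the disc, each for a reason of its own; the sub-mean
value inequality for log |z|^2 + psi(w) is a third matter.

The minimum. For f holomorphic with f(0) = 1, the inequality
|f|^2 >= 2 Re f - 1 and the mean value property of Re f on circles around 0
show that |f|^2 has mean at least 1 on every such circle ([sq_mean_value]).
As phi is constant on these circles and Lebesgue measure is rotation
invariant, the weighted norm of f is at least that of the constant 1
([min_norm_extension]). The mean value property comes from a Goursat argument
in polar coordinates ([goursat_ray], [mean_value]).

The equality of the integrals of exp(-phi) and exp(-psi). For z, w in the disc
the conditions |w|^2 < exp(-phi z) and |z|^2 < exp(-psi w) say the same thing,
because psi is defined from the inverse of u ([weight_psi_dual]). Both
integrals thus compute, up to the area of the unit disc, the volume of the set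
of these pairs by the two orders of integration ([area_exchange], [area_psi]).

Plurisubharmonicity. The convex function u has supporting lines, and -u^-1
inherits them, so that psi(w) >= psi(w0) + k (log |w|^2 - log |w0|^2) with
k > 0. On a complex line, log |z|^2 and log |w|^2 become logarithms of the
moduli of affine functions, and the sub-mean value inequality reduces to
int_0^{2 pi} log |1 + c e^{it}|^2 dt >= 0 ([integral_lne_trig], [log_sq_circle],
[log_sum_submean], [tG_plurisubharmonic]). That inequality is obtained from
(A + a cos t + b sin t) (A - a cos t - b sin t) being again of the same shape in
2t: iterating this doubles the integral of the logarithm each time, while the
integrals stay bounded from below ([integral_ln_trig_ge]).

In part (b), phi_eps = phi + eps h(log |z|^2) with h(t) = - log (1 - e^t), a
strictly convex increasing function that tends to +oo at 0, so that phi_eps is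
an exhaustive weight ([phi_eps_exhaustive]); the integrals of exp(-psi_eps) and
exp(-phi_eps) agree, and the latter tend to that of exp(-phi) by dominated
convergence ([area_phi_eps_cvg]). *)

(** * Lebesgue measure on the plane: rotations, discs and open sets *)

Notation leb2 R := ((@lebesgue_measure R) \x (@lebesgue_measure R))%E.

Lemma measurable_affine (R : realType) (k b : R) :
  measurable_fun setT (fun x : R => k * x + b).
Proof.
apply: continuous_measurable_fun => x.
by apply: cvgD; [apply: cvgMr; exact: cvg_id|exact: cvg_cst].
Qed.

(** The right-hand side is, as a function of A, a measure with the right value
on intervals, and Lebesgue measure is the only one. *)
Lemma lebesgue_measure_affine (R : realType) (k b : R) (A : set R) :
  0 < k -> measurable A ->
  lebesgue_measure A =
  (k%:E * lebesgue_measure ((fun x : R => (k * x + b)%R) @^-1` A))%E.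
Proof.
move=> k0 mA.
pose f : R -> measurableTypeR R := fun x => k * x + b.
have mf : measurable_fun setT f by exact: measurable_affine.
rewrite [LHS](@lebesgue_measure_unique R
  (mscale (NngNum (ltW k0)) (pushforward lebesgue_measure f)))//.
move=> _ [[x y]] _ <- /=.
change (lebesgue_measure `]x, y]%classic =
  (k%:E * lebesgue_measure (f @^-1` `]x, y]%classic))%E).
have -> : f @^-1` `]x, y] = `](x - b) / k, (y - b) / k]%classic.
  apply/seteqP; split => t /=; rewrite !in_itv/= /f => /andP[];
  rewrite ?ltr_pdivrMr ?ler_pdivlMr// => h1 h2; apply/andP; split; lra.
rewrite !lebesgue_measure_itv/= !lte_fin ltr_pM2r ?invr_gt0// ltrD2r.
case: ifPn => xy; last by rewrite mule0.
by rewrite -!EFinD -EFinM; congr EFin; field; rewrite gt_eqF.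
Qed.

Lemma ge0_integral_affine (R : realType) (k b : R) (f : R -> \bar R) :
  0 < k -> measurable_fun setT f -> (forall x, (0 <= f x)%E) ->
  (\int[lebesgue_measure]_x f x =
   k%:E * \int[lebesgue_measure]_x f (k * x + b)%R)%E.
Proof.
move=> k0 mf f0.
pose g : measurableTypeR R -> measurableTypeR R := fun x : R => k * x + b.
have mg : measurable_fun setT g by exact: measurable_affine.
have := @ge0_integral_pushforward _ _ _ _ _ g mg (@lebesgue_measure R) setT f
  measurableT mf (fun y _ => f0 y).
rewrite preimage_setT => <-.
have := @ge0_integral_mscale _ _ R (pushforward (@lebesgue_measure R) g) setT
  measurableT (NngNum (ltW k0)) f mf (fun y _ => f0 y).
move=> /= <-.
by apply: eq_measure_integral => A mA _; exact: lebesgue_measure_affine.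
Qed.

Lemma tonelli_plane (R : realType) (f : R * R -> \bar R) :
  measurable_fun setT f -> (forall p, (0 <= f p)%E) ->
  [/\ (\int[leb2 R]_p f p =
       \int[@lebesgue_measure R]_x \int[@lebesgue_measure R]_y f (x, y))%E,
      (\int[leb2 R]_p f p =
       \int[@lebesgue_measure R]_y \int[@lebesgue_measure R]_x f (x, y))%E,
      measurable_fun setT (fun x : R => \int[@lebesgue_measure R]_y f (x, y))%E &
      measurable_fun setT (fun y : R => \int[@lebesgue_measure R]_x f (x, y))%E].
Proof.
move=> mf f0; split.
- by rewrite fubini_tonelli1.
- by rewrite fubini_tonelli2.
- exact: (@measurable_fun_fubini_tonelli_F _ _ _ _ _ (@lebesgue_measure R) f mf f0).
- exact: (@measurable_fun_fubini_tonelli_G _ _ _ _ _ (@lebesgue_measure R) f mf f0).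
Qed.

(** A change of one coordinate at a time is an affine change of variable on
each line; by Tonelli it scales the integral by its factor. *)
Lemma ge0_integral_shear1 (R : realType) (k a : R) (f : R * R -> \bar R) :
  0 < k -> measurable_fun setT f -> (forall p, (0 <= f p)%E) ->
  (\int[leb2 R]_p f p =
   k%:E * \int[leb2 R]_p
            f ((k * p.1 + a * p.2)%R, p.2))%E.
Proof.
move=> k0 mf f0.
have mg : measurable_fun setT (fun p : R * R => f (k * p.1 + a * p.2, p.2)).
  apply: (measurableT_comp mf); apply: measurable_fun_pair => //=.
  by apply: measurable_funD; apply: measurable_funM.
have [_ -> _ _] := tonelli_plane mf f0.
have [_ -> _ mG] := tonelli_plane mg (fun p => f0 _).
rewrite -ge0_integralZl ?lee_fin ?ltW//; last first.
  by move=> y _; exact: integral_ge0.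
apply: eq_integral => y _; rewrite /=.
apply: (@ge0_integral_affine _ k (a * y) (fun x => f (x, y))) => //.
exact: (measurableT_comp mf).
Qed.

Lemma ge0_integral_shear2 (R : realType) (k a : R) (f : R * R -> \bar R) :
  0 < k -> measurable_fun setT f -> (forall p, (0 <= f p)%E) ->
  (\int[leb2 R]_p f p =
   k%:E * \int[leb2 R]_p
            f (p.1, (k * p.2 + a * p.1)%R))%E.
Proof.
move=> k0 mf f0.
have mg : measurable_fun setT (fun p : R * R => f (p.1, k * p.2 + a * p.1)).
  apply: (measurableT_comp mf); apply: measurable_fun_pair => //=.
  by apply: measurable_funD; apply: measurable_funM.
have [-> _ _ _] := tonelli_plane mf f0.
have [-> _ mF _] := tonelli_plane mg (fun p => f0 _).
rewrite -ge0_integralZl ?lee_fin ?ltW//; last first.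
  by move=> y _; exact: integral_ge0.
apply: eq_integral => x _; rewrite /=.
apply: (@ge0_integral_affine _ k (a * x) (fun y => f (x, y))) => //.
exact: (measurableT_comp mf).
Qed.

Definition rot (R : realType) (c s : R) (p : R * R) : R * R :=
  (c * p.1 - s * p.2, s * p.1 + c * p.2).

Lemma measurable_rot (R : realType) (c s : R) :
  measurable_fun setT (@rot R c s).
Proof.
apply: measurable_fun_pair => /=.
  by apply: measurable_funB; apply: measurable_funM.
by apply: measurable_funD; apply: measurable_funM.
Qed.

(** A rotation with cosine c <> -1 is a product of three shears, with slopes
-tau, s and -tau for tau = s / (1 + c), the tangent of the half angle. The
rotation by pi is the square of the rotation by pi / 2. *)
Lemma ge0_integral_rot (R : realType) (c s : R) (f : R * R -> \bar R) :
  c ^+ 2 + s ^+ 2 = 1 -> measurable_fun setT f -> (forall p, (0 <= f p)%E) ->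
  (\int[leb2 R]_p f (rot c s p) =
   \int[leb2 R]_p f p)%E.
Proof.
move=> cs mf f0.
wlog c1 : c s f cs mf f0 / c != -1 => [hw|].
  have [c1|] := eqVneq c (- 1); last exact: hw.
  have s0 : s = 0.
    by apply/eqP; rewrite -sqrf_eq0; apply/eqP; move: cs; rewrite c1; lra.
  have -> : (fun p => f (rot c s p)) =
      (fun p => (f \o rot 0 1) (rot 0 1 p)).
    by apply/funext => p; rewrite /rot /= c1 s0; congr (f (_, _)); ring.
  have r0 : (0 : R) != - 1 by rewrite eq_sym oppr_eq0 oner_eq0.
  rewrite !hw//; try (by rewrite expr0n expr1n add0r).
  exact: measurableT_comp (measurable_rot _ _).
  by move=> p; exact: f0.
have c1' : 1 + c != 0 by apply: contraNneq c1 => h; apply/eqP; lra.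
(* rot c s = shear by -tau, then by s, then by -tau. *)
pose tau := s / (1 + c).
pose g (p : R * R) := f (p.1 - tau * p.2, p.2).
pose h (p : R * R) := g (p.1, p.2 + s * p.1).
have mg : measurable_fun setT g.
  apply: (measurableT_comp mf); apply: measurable_fun_pair => //=.
  by apply: measurable_funB => //; apply: measurable_funM.
have mh : measurable_fun setT h.
  apply: (measurableT_comp mg); apply: measurable_fun_pair => //=.
  by apply: measurable_funD => //; apply: measurable_funM.
have -> : (fun p => f (rot c s p)) = (fun p => h (p.1 - tau * p.2, p.2)).
  have st : s * tau = 1 - c.
    by rewrite /tau mulrA -expr2 (_ : s ^+ 2 = (1 - c) * (1 + c)) ?mulfK//; lra.
  have tc : tau * c = s - tau by rewrite /tau; field.
  apply/funext => p; rewrite /h /g /rot /=; congr (f (_, _)); last first.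
    rewrite mulrBr mulrA st; ring.
  rewrite mulrDr (mulrBr s) (mulrA s) st mulrBr (mulrA tau s) (mulrC tau s) st.
  rewrite mulrA mulrBr mulr1 tc; ring.
transitivity (\int[leb2 R]_p h p)%E.
  rewrite [RHS](@ge0_integral_shear1 _ 1 (- tau)) ?mul1e//; last by move=> p; exact: f0.
  by apply: eq_integral => p _; rewrite mul1r mulNr.
transitivity (\int[leb2 R]_p g p)%E.
  rewrite [RHS](@ge0_integral_shear2 _ 1 s) ?mul1e//; last by move=> p; exact: f0.
  by apply: eq_integral => p _; rewrite mul1r.
rewrite [RHS](@ge0_integral_shear1 _ 1 (- tau)) ?mul1e//.
by apply: eq_integral => p _; rewrite mul1r mulNr.
Qed.

(** The radius is sqrt rho: with the square of the radius as the parameter,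
the area is linear in rho. *)
Definition plane_disc (R : realType) (rho : R) : set (R * R) :=
  [set p | p.1 ^+ 2 + p.2 ^+ 2 < rho].

Lemma measurable_plane_disc (R : realType) (rho : R) :
  measurable (@plane_disc R rho).
Proof.
rewrite -[plane_disc rho]setTI.
have m : measurable_fun setT (fun p : R * R => p.1 ^+ 2 + p.2 ^+ 2).
  by apply: measurable_funD; apply: measurable_funX.
have := m measurableT `]-oo, rho[%classic (measurable_itv _).
by congr measurable; apply/seteqP; split => p /=; rewrite in_itv/=.
Qed.

(** Dilation of each coordinate by sqrt rho. *)
Lemma plane_disc_area (R : realType) (rho : R) : 0 <= rho ->
  (leb2 R (plane_disc rho) =
   rho%:E * leb2 R (plane_disc (1 : R)))%E.
Proof.
rewrite le_eqVlt => /predU1P[<-|rho0].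
  rewrite mul0e (_ : plane_disc 0 = set0) ?measure0// -subset0 => p /=.
  by rewrite /plane_disc /= ltNge addr_ge0 ?sqr_ge0.
pose r := Num.sqrt rho; have r0 : 0 < r by rewrite sqrtr_gt0.
have r2 : r ^+ 2 = rho by rewrite sqr_sqrtr// ltW.
have mI (t : R) : measurable_fun setT (fun p : R * R => (\1_(plane_disc t) p : R)%:E).
  by apply/measurable_EFinP; apply: measurable_indic; exact: measurable_plane_disc.
have mI1 : measurable_fun setT
    (fun p : R * R => (\1_(plane_disc rho) (r * p.1, p.2) : R)%:E).
  apply: (measurableT_comp (mI rho)).
  by apply: measurable_fun_pair => //; apply: measurable_funM.
rewrite -[plane_disc rho]setIT -[plane_disc 1]setIT -!integral_indic//;
  try exact: measurable_plane_disc.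
rewrite (@ge0_integral_shear1 _ r 0)//.
rewrite (_ : (fun p : R * R => _) =
    fun p : R * R => (\1_(plane_disc rho) (r * p.1, p.2) : R)%:E)%E; last first.
  by apply/funext => p; rewrite mul0r addr0.
rewrite (@ge0_integral_shear2 _ r 0)//.
rewrite muleA -EFinM -expr2 r2; congr (_ * _)%E; apply: eq_integral => p _ /=.
rewrite mul0r addr0; congr EFin; rewrite !indicE; congr (nat_of_bool _)%:R.
apply/idP/idP; rewrite !inE /plane_disc /= !exprMn r2 -mulrDr.
  by rewrite -ltr_pdivlMl// mulVf ?gt_eqF.
by rewrite -ltr_pdivlMl// mulVf ?gt_eqF.
Qed.

(** The disc contains the square [0, 1/2]^2 and lies in [-1, 1]^2. *)
Lemma plane_disc_area_gt0_lty (R : realType) :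
  (0 < leb2 R (plane_disc (1 : R)) < +oo)%E.
Proof.
have m1 := measurable_plane_disc (1 : R).
pose B (x y : R) : set (R * R) := `[x, y]%classic `*` `[x, y]%classic.
have mb (x y : R) : measurable (B x y).
  by apply: measurableX; exact: measurable_itv.
have hB x y : x < y -> leb2 R (B x y) = ((y - x) * (y - x))%:E.
  move=> xy; rewrite /B (@product_measure1E _ _ _ _ R (@lebesgue_measure R)
    (@lebesgue_measure R))//; try exact: measurable_itv.
  have hl : lebesgue_measure `[x, y]%classic = (y - x)%:E.
    by rewrite lebesgue_measure_itv /= lte_fin xy -EFinB.
  by rewrite EFinM; congr (_ * _)%E; exact: hl.
apply/andP; split.
  have : (leb2 R
     (B 0%R 2^-1%R) <=
     leb2 R (plane_disc (1 : R)))%E.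
    apply: le_measure; [by rewrite inE; exact: mb|by rewrite inE; exact: m1|].
    move=> -[x y]; rewrite /B /= !in_itv/= /plane_disc /= => -[/andP[x0 x1] /andP[y0 y1]].
    nra.
  apply: lt_le_trans; rewrite hB ?invr_gt0// lte_fin.
have : (leb2 R (plane_disc (1 : R)) <=
   leb2 R
     (B (-1)%R 1%R))%E.
  apply: le_measure; [by rewrite inE; exact: m1|by rewrite inE; exact: mb|].
  move=> -[x y]; rewrite /B /= !in_itv/= /plane_disc /= => xy; split; apply/andP; split; nra.
move=> /le_lt_trans; apply; by rewrite hB ?ltry//; lra.
Qed.

(** An open set is the countable union of the rational boxes that it contains.
*)
Lemma open_measurable_plane (R : realType) (A : set (R * R)) :
  open A -> measurable A.
Proof.
move=> oA.
pose box (q : (rat * rat) * (rat * rat)) : set (R * R) :=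
  `]ratr q.1.1, ratr q.1.2[%classic `*` `]ratr q.2.1, ratr q.2.2[%classic.
have -> : A = \bigcup_(q in [set q | box q `<=` A]) box q.
  apply/seteqP; split => [[x y] Axy|[x y] [q /= qA]]; last exact: qA.
  have [e /= e0 eA] : nbhs_ball (x, y) A by exact/nbhs_ballP/open_nbhs_nbhs.
  have [q1] := @rat_in_itvoo R (x - e) x ltac:(lra); rewrite in_itv/= => /andP[a1 b1].
  have [q2] := @rat_in_itvoo R x (x + e) ltac:(lra); rewrite in_itv/= => /andP[a2 b2].
  have [q3] := @rat_in_itvoo R (y - e) y ltac:(lra); rewrite in_itv/= => /andP[a3 b3].
  have [q4] := @rat_in_itvoo R y (y + e) ltac:(lra); rewrite in_itv/= => /andP[a4 b4].
  exists ((q1, q2), (q3, q4)); last first.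
    by rewrite /box /=; split; rewrite /= in_itv/=; apply/andP.
  move=> [x' y']; rewrite /box /= !in_itv/= => -[/andP[h1 h2] /andP[h3 h4]].
  apply: eA; split; rewrite /= /ball /= ltr_norml; apply/andP; split; lra.
rewrite bigcup_mkcond; apply: countable_bigcupT_measurable => // q.
by case: ifPn => // _; apply: measurableX; exact: measurable_itv.
Qed.

(** * Integrals of periodic functions *)

Lemma continuous_integrable_itv (R : realType) (a b : R) (g : R -> R) :
  continuous g -> (@lebesgue_measure R).-integrable `[a, b] (EFin \o g).
Proof.
move=> cg; apply: continuous_compact_integrable; first exact: segment_compact.
by apply: continuous_subspaceT.
Qed.

Lemma ge0_integral_itv_shift (R : realType) (a b c : R) (g : R -> \bar R) :
  measurable_fun setT g -> (forall t, (0 <= g t)%E) ->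
  (\int[@lebesgue_measure R]_(t in `[a, b[) g (t + c)%R =
   \int[@lebesgue_measure R]_(t in `[(a + c)%R, (b + c)%R[) g t)%E.
Proof.
move=> mg g0; rewrite [LHS]integral_mkcond [RHS]integral_mkcond.
rewrite [RHS](@ge0_integral_affine _ 1 c)//; first last.
- by move=> x; apply: erestrict_ge0.
- apply/(measurable_restrictT _ (measurable_itv _)).
  exact: measurable_funS mg.
rewrite mul1e; apply: eq_integral => t _; rewrite /patch mul1r.
have -> // : (t \in `[a, b[%classic) = (t + c \in `[a + c, b + c[%classic).
by apply/idP/idP; rewrite !inE/= !in_itv/= => /andP[h1 h2]; apply/andP; split; lra.
Qed.

Lemma ge0_integral_periodic (R : realType) (T s : R) (g : R -> \bar R) :
  0 <= s <= T -> measurable_fun setT g -> (forall t, (0 <= g t)%E) ->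
  (forall t, g (t + T) = g t) ->
  (\int[@lebesgue_measure R]_(t in `[0%R, T]) g (t + s)%R =
   \int[@lebesgue_measure R]_(t in `[0%R, T]) g t)%E.
Proof.
move=> /andP[s0 sT] mg g0 gT.
have mgs : measurable_fun setT (fun t : R => g (t + s)).
  apply: (measurableT_comp mg); have := @measurable_affine R 1 s.
  by under eq_fun do rewrite mul1r.
have split_at (a b c : R) : a <= b -> b <= c ->
    (\int[@lebesgue_measure R]_(t in `[a, c[) g t =
     \int[@lebesgue_measure R]_(t in `[a, b[) g t +
     \int[@lebesgue_measure R]_(t in `[b, c[) g t)%E.
  move=> ab bc; have -> : `[a, c[%classic = `[a, b[%classic `|` `[b, c[%classic.
    by rewrite (@itv_bndbnd_setU _ _ _ (BLeft b)).
  rewrite ge0_integral_setU//; first exact: measurable_funTS.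
  apply/disj_setPS => t [] /=; rewrite !in_itv/= => /andP[_ h1] /andP[h2 _].
  by move: h1; rewrite ltNge h2.
rewrite -!(@integral_itv_bndo_bndc _ _ T) //; try exact: measurable_funTS.
rewrite ge0_integral_itv_shift// add0r (split_at s T (T + s))//; last by lra.
rewrite [RHS](split_at 0 s T)// addeC; congr (_ + _)%E.
transitivity (\int[@lebesgue_measure R]_(t in `[0%R, s[) g (t + T)%R)%E.
  by rewrite ge0_integral_itv_shift// add0r addrC.
by apply: eq_integral => t _; rewrite gT.
Qed.

(** The nonnegative case applies to g - c. *)
Lemma Rintegral_periodic (R : realType) (T s c : R) (g : R -> R) :
  0 <= s <= T -> continuous g -> (forall t, c <= g t) ->
  (forall t, g (t + T) = g t) ->
  \int[@lebesgue_measure R]_(t in `[0, T]) g (t + s) =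
  \int[@lebesgue_measure R]_(t in `[0, T]) g t.
Proof.
move=> sT cg gc gT.
have cgs : continuous (fun t => g (t + s)).
  move=> t; apply: (@continuous_comp _ _ _ (fun t => t + s) g); last exact: cg.
  by apply: cvgD; [exact: cvg_id|exact: cvg_cst].
have cc : continuous (fun _ : R => c) by move=> ?; exact: cvg_cst.
have sub (h : R -> R) : continuous h -> (forall t, c <= h t) ->
    \int[@lebesgue_measure R]_(t in `[0, T]) h t =
    fine (\int[@lebesgue_measure R]_(t in `[0%R, T]) (h t - c)%:E)%E +
    \int[@lebesgue_measure R]_(t in `[0, T]) c.
  move=> ch hc; rewrite -[X in X + _]/(Rintegral _ _ _) -RintegralD//.
  - by apply: eq_Rintegral => t _; rewrite subrK.
  - apply: continuous_integrable_itv => t.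
    by apply: cvgB; [exact: ch|exact: cvg_cst].
  - exact: continuous_integrable_itv.
rewrite (sub _ cgs)// (sub _ cg)//; congr (fine _ + _).
apply: (@ge0_integral_periodic _ T s (fun t => (g t - c)%:E)) => //.
- apply/measurable_EFinP; apply: measurable_funB => //.
  exact: continuous_measurable_fun.
- by move=> t; rewrite lee_fin subr_ge0.
- by move=> t; rewrite gT.
Qed.

(** * The mean of log |1 + c e^(it)|^2 *)

(** With B^2 = a^2 + b^2, this function oscillates between A - B and A + B
with frequency m. For m = 1 and A = 1 + B^2 / 4 it is the square of the
modulus of an affine function on a circle. *)
Definition trig (R : realType) (A a b m t : R) : R :=
  A + a * cos (m * t) + b * sin (m * t).

Lemma trig_shift (R : realType) (A a b m t : R) : m != 0 ->
  trig A a b m (t + pi / m) = trig A (- a) (- b) m t.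
Proof.
move=> m0; rewrite /trig mulrDr mulrCA divff// mulr1 cosDpi sinDpi; ring.
Qed.

Lemma trig_periodic (R : realType) (A a b : R) (m : nat) t :
  trig A a b m%:R (t + 2 * pi) = trig A a b m%:R t.
Proof.
rewrite /trig mulrDr (_ : m%:R * (2 * pi) = (pi *+ 2) *+ m); last first.
  by rewrite -[RHS]mulr_natl -[pi *+ 2]mulr_natl.
by rewrite (periodicn (@cosD2pi R)) (periodicn (@sinD2pi R)).
Qed.

(** The product of the two factors that half a period exchanges is a function
of the same family with doubled frequency. *)
Lemma trig_mul (R : realType) (A a b m t : R) :
  trig A a b m t * trig A (- a) (- b) m t =
  trig (A ^+ 2 - (a ^+ 2 + b ^+ 2) / 2) ((b ^+ 2 - a ^+ 2) / 2) (- (a * b))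
    (2 * m) t.
Proof.
rewrite /trig (_ : 2 * m * t = (m * t) *+ 2) ?cos_mulr2n ?sin_mulr2n; last first.
  by rewrite -mulrA mulr_natl.
have := cos2Dsin2 (m * t); move: (cos _) (sin _) => c s cs.
have -> : (A + a * c + b * s) * (A + - a * c + - b * s) =
  A ^+ 2 - a ^+ 2 * c ^+ 2 - 2 * a * b * c * s - b ^+ 2 * s ^+ 2 by ring.
have -> : s ^+ 2 = 1 - c ^+ 2 by lra.
by field.
Qed.

Lemma trig_ge (R : realType) (A a b B m t : R) :
  0 <= B -> a ^+ 2 + b ^+ 2 = B ^+ 2 -> A - B <= trig A a b m t.
Proof.
move=> B0 abB; rewrite /trig; have := cos2Dsin2 (m * t).
move: (cos _) (sin _) => c s cs.
suff : (- (a * c + b * s)) <= B by lra.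
apply: (le_trans (ler_norm _)); rewrite -(@ler_pXn2r _ 2%N)// ?nnegrE//.
rewrite real_normK ?num_real//.
have : (a * c + b * s) ^+ 2 + (a * s - b * c) ^+ 2 = B ^+ 2.
  by rewrite -abB -[RHS]mulr1 -cs; ring.
have := sqr_ge0 (a * s - b * c); rewrite sqrrN; lra.
Qed.

Lemma continuous_trig (R : realType) (A a b m : R) : continuous (trig A a b m).
Proof.
have cm : continuous (fun t : R => m * t).
  by move=> t; apply: cvgMr; exact: cvg_id.
move=> t; rewrite /trig; apply: cvgD.
  apply: cvgD; first exact: cvg_cst.
  apply: cvgMr; apply: (continuous_comp (cm t)); exact: continuous_cos.
apply: cvgMr; apply: (continuous_comp (cm t)); exact: continuous_sin.
Qed.

Lemma continuous_ln_trig (R : realType) (A a b m : R) :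
  (forall t, 0 < trig A a b m t) -> continuous (fun t => ln (trig A a b m t)).
Proof.
move=> p t; apply: (@continuous_comp _ _ _ (trig A a b m) (@ln R)).
  exact: continuous_trig.
by apply: continuous_ln.
Qed.

(** Induction on n with frequency doubling. By half a period of shift, twice
the integral of ln (trig A a b m) is that of the logarithm of the product in
[trig_mul], whose parameters are A^2 - B^2 / 2 and B^2 / 2; they satisfy the
same hypotheses with the same lower bound d, as 1 + B^2 / 4 <= A is stable
under this operation. For n = 0 the integrand is at least ln d. *)
Lemma integral_ln_trig_ge (R : realType) (d : R) (n m : nat) (A a b B : R) :
  (0 < m)%N -> 0 <= B -> a ^+ 2 + b ^+ 2 = B ^+ 2 -> 1 + B ^+ 2 / 4 <= A ->
  0 < d -> d <= A - B ->
  2 * pi * ln d / 2 ^+ n <=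
  \int[@lebesgue_measure R]_(t in `[0, 2 * pi]) ln (trig A a b m%:R t).
Proof.
move=> m0 B0 abB AB d0 dAB; elim: n m m0 A a b B B0 abB AB dAB => [|n IH].
  move=> m m0 A a b B B0 abB AB dAB; rewrite expr0 divr1.
  have tp t : d <= trig A a b m%:R t.
    by apply: (le_trans dAB); exact: trig_ge.
  have -> : 2 * pi * ln d =
      \int[@lebesgue_measure R]_(t in `[0, 2 * pi]) ln d.
    rewrite Rintegral_cst//= lebesgue_measure_itv/= lte_fin mulr_gt0 ?pi_gt0//.
    by rewrite -EFinB /= subr0 mulrC.
  apply: le_Rintegral => //.
  - by apply: continuous_integrable_itv => ?; exact: cvg_cst.
  - apply: continuous_integrable_itv; apply: continuous_ln_trig => t.
    exact: lt_le_trans (tp t).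
  - by move=> t _; rewrite ler_ln ?posrE// (lt_le_trans d0).
move=> m m0 A a b B B0 abB AB dAB.
have mR0 : (0 : R) < m%:R by rewrite ltr0n.
have abB' : (- a) ^+ 2 + (- b) ^+ 2 = B ^+ 2 by rewrite !sqrrN.
have tp a' b' (h : a' ^+ 2 + b' ^+ 2 = B ^+ 2) t : d <= trig A a' b' m%:R t.
  by apply: (le_trans dAB); exact: trig_ge.
have cp a' b' (h : a' ^+ 2 + b' ^+ 2 = B ^+ 2) :
    continuous (fun t => ln (trig A a' b' m%:R t)).
  by apply: continuous_ln_trig => t; exact: lt_le_trans (tp _ _ h t).
have shift : \int[@lebesgue_measure R]_(t in `[0, 2 * pi])
      ln (trig A (- a) (- b) m%:R t) =
    \int[@lebesgue_measure R]_(t in `[0, 2 * pi]) ln (trig A a b m%:R t).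
  rewrite -[RHS](@Rintegral_periodic R (2 * pi) (pi / m%:R) (ln d)
    (fun t => ln (trig A a b m%:R t))).
  - by apply: eq_Rintegral => t _; rewrite trig_shift// gt_eqF.
  - apply/andP; split; first by rewrite divr_ge0 ?pi_ge0.
    rewrite ler_pdivrMr// mulrC mulrA -[leLHS]mul1r ler_wpM2r ?pi_ge0//.
    have : (1 : R) <= m%:R by rewrite ler1n.
    lra.
  - exact: cp.
  - by move=> t; rewrite ler_ln ?posrE// ?(lt_le_trans d0) ?tp.
  - by move=> t; rewrite trig_periodic.
have dbl : \int[@lebesgue_measure R]_(t in `[0, 2 * pi]) ln (trig A a b m%:R t) * 2 =
    \int[@lebesgue_measure R]_(t in `[0, 2 * pi])
      ln (trig (A ^+ 2 - B ^+ 2 / 2) ((b ^+ 2 - a ^+ 2) / 2) (- (a * b)) (2 * m)%:R t).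
  rewrite mulr_natr mulr2n -{2}shift -RintegralD//; last 2 first.
  - by apply: continuous_integrable_itv; exact: cp.
  - by apply: continuous_integrable_itv; exact: cp.
  apply: eq_Rintegral => t _; rewrite -lnM ?posrE//; last 2 first.
  - exact: lt_le_trans (tp _ _ abB t).
  - exact: lt_le_trans (tp _ _ abB' t).
  by rewrite trig_mul natrM abB.
rewrite (exprSr 2 n) invfM mulrA ler_pdivrMr// dbl.
apply: (IH (2 * m)%N _ _ _ _ (B ^+ 2 / 2)).
- by rewrite muln_gt0.
- by rewrite divr_ge0 ?sqr_ge0.
- by rewrite -abB; field.
- have : (1 + B ^+ 2 / 4) ^+ 2 <= A ^+ 2.
    by rewrite ler_pXn2r ?nnegrE//; have := sqr_ge0 B; lra.
  by rewrite (_ : (1 + B ^+ 2 / 4) ^+ 2 = 1 + B ^+ 2 / 2 + (B ^+ 2 / 2) ^+ 2 / 4); [lra|field].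
- have -> : A ^+ 2 - B ^+ 2 / 2 - B ^+ 2 / 2 = (A - B) * (A + B) by field.
  have A1 : 1 <= A + B by have := sqr_ge0 B; lra.
  rewrite (le_trans dAB)// ler_peMr//; lra.
Qed.

(** The lower bounds of [integral_ln_trig_ge] tend to 0 with n. *)
Lemma integral_ln_trig_ge0 (R : realType) (m : nat) (A a b B : R) :
  (0 < m)%N -> 0 <= B -> a ^+ 2 + b ^+ 2 = B ^+ 2 -> 1 + B ^+ 2 / 4 <= A ->
  B < A ->
  0 <= \int[@lebesgue_measure R]_(t in `[0, 2 * pi]) ln (trig A a b m%:R t).
Proof.
move=> m0 B0 abB AB BA.
set K := (X in 0 <= X); rewrite leNgt; apply/negP => K0.
have hK n := @integral_ln_trig_ge R (A - B) n m A a b B m0 B0 abB AB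
  ltac:(by rewrite subr_gt0) (lexx _).
pose C := `|2 * pi * ln (A - B)|.
have hC n : 2 ^+ n * - K <= C.
  have := hK n; rewrite -/K ler_pdivrMr ?exprn_gt0// => h.
  rewrite /C -normrN (le_trans _ (ler_norm _))//; lra.
pose n := Num.bound (C / - K).
have := hC n; apply/negP; rewrite -ltNge.
have K0' : 0 < - K by rewrite oppr_gt0.
have : C / - K < n%:R by apply: archi_boundP; rewrite divr_ge0 ?normr_ge0// ltW.
rewrite ltr_pdivrMr// => /lt_le_trans; apply; rewrite ler_pM2r//.
by rewrite -natrX ler_nat ltnW// ltn_expl.
Qed.

Lemma measurable_lne_comp (R : realType) d (T : measurableType d) (D : set T)
    (f : T -> R) : measurable D ->
  measurable_fun D f -> measurable_fun D (fun t => lne (f t)%:E).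
Proof.
move=> mD mf; rewrite (_ : (fun _ => _) =
  fun t => if f t <= 0 then -oo%E else (ln (f t))%:E)//.
apply: measurable_fun_if => //.
- by apply: measurable_fun_ler.
- apply/measurable_EFinP; apply: (measurableT_comp (@measurable_ln R)).
  exact: measurable_funS mf.
Qed.

(** The value +oo is reached at x = 0, where ln is regularized by harmonic n.
*)
Lemma cvg_sub_ln_lne (R : realType) (M x : R) : 0 <= x ->
  (M - ln (x + @harmonic R n))%:E @[n --> \oo] --> (M%:E - lne x%:E)%E.
Proof.
rewrite le_eqVlt => /predU1P[<-|x0].
  rewrite le0_lneNy// addey//.
  apply/cvgeyPge => A; near=> n; rewrite lee_fin add0r.
  rewrite lerBrDl addrC -lerBrDl -[leRHS]expRK.
  have h0 : 0 < @harmonic R n by rewrite /harmonic/= invr_gt0.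
  rewrite ler_ln ?posrE ?expR_gt0//.
  near: n; have : \forall n \near \oo, `|@harmonic R n| <= expR (M - A).
    by have := @cvg_harmonic R => /cvgr0_norm_le; apply; exact: expR_gt0.
  by apply: filterS => n /(le_trans (ler_norm _)).
rewrite lne_EFin// -EFinB; apply: cvg_EFin; first exact: nearW.
apply: cvgB; first exact: cvg_cst.
have xh : x + harmonic n @[n --> \oo] --> x.
  by rewrite -[X in _ --> X]addr0; apply: cvgD; [exact: cvg_cst|exact: cvg_harmonic].
exact: (continuous_cvg _ (continuous_ln x0) xh).
Unshelve. all: by end_near. Qed.

(** The equality A = B is allowed, so that the argument of the logarithm may
vanish. Then A is replaced by A + 1 / (n + 1), where the integral is
nonnegative, and M minus the logarithm, for an upper bound M, increases with n
to a function whose integral is at most 2 pi M by monotone convergence. *)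
Lemma integral_lne_trig (R : realType) (A a b B : R) :
  0 <= B -> a ^+ 2 + b ^+ 2 = B ^+ 2 -> 1 + B ^+ 2 / 4 <= A ->
  (@lebesgue_measure R).-integrable `[0, 2 * pi]
    (fun t => lne (trig A a b 1 t)%:E) /\
  (0 <= \int[@lebesgue_measure R]_(t in `[0%R, (2 * pi)%R]) lne (trig A a b 1 t)%:E)%E.
Proof.
move=> B0 abB AB.
have BA : B <= A by have := sqr_ge0 (1 - B / 2); nra.
have tp t : 0 <= trig A a b 1 t.
  by apply: (le_trans _ (trig_ge A 1 t B0 abB)); rewrite subr_ge0.
have tub t : trig A a b 1 t <= A + B.
  have := trig_ge (- A) 1 t B0 (_ : (- a) ^+ 2 + (- b) ^+ 2 = B ^+ 2).
  rewrite !sqrrN => /(_ abB); rewrite /trig; lra.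
pose M := ln (A + B + 1).
have A1 : 1 <= A by have := sqr_ge0 B; lra.
have M0 : 0 <= M by rewrite ln_ge0//; lra.
pose I := `[0, 2 * pi]%classic : set R.
have mI : measurable I by exact: measurable_itv.
have lI : @lebesgue_measure R I = (2 * pi)%:E.
  by rewrite lebesgue_measure_itv/= lte_fin mulr_gt0 ?pi_gt0// -EFinB subr0.
have trigD d t : trig A a b 1 t + d = trig (A + d) a b 1 t.
  by rewrite /trig; ring.
have h0 n : 0 < @harmonic R n by rewrite /harmonic/= invr_gt0.
have h1 n : @harmonic R n <= 1.
  by rewrite /harmonic/= invf_le1 ?ltr0n// ler1n.
pose g n t := (M - ln (trig A a b 1 t + @harmonic R n))%:E.
have cg n : continuous (fun t => ln (trig A a b 1 t + @harmonic R n)).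
  rewrite (_ : (fun t => _) = fun t => ln (trig (A + harmonic n) a b 1 t)); last first.
    by apply/funext => t; rewrite trigD.
  by apply: continuous_ln_trig => t; rewrite -trigD ltr_wpDl.
have mg n : measurable_fun I (g n).
  apply/measurable_EFinP; apply: measurable_funB => //.
  by apply: measurable_funTS; exact: continuous_measurable_fun.
have g0 n t : I t -> (0 <= g n t)%E.
  move=> _; rewrite lee_fin subr_ge0 ler_ln ?posrE ?ltr_wpDl//; last by lra.
  by apply: lerD.
have ndg t : I t -> nondecreasing_seq (g ^~ t).
  move=> _ m n mn; rewrite lee_fin lerB// ler_ln ?posrE ?ltr_wpDl// lerD2l.
  by rewrite /harmonic/= lef_pV2 ?posrE ?ltr0n// ler_nat.
have gl t : (M%:E - lne (trig A a b 1 t)%:E)%E = limn (g ^~ t).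
  by apply/esym/cvg_lim => //; exact: cvg_sub_ln_lne.
have ig n : (\int[@lebesgue_measure R]_(t in I) g n t <= (2 * pi * M)%:E)%E.
  have -> : (\int[@lebesgue_measure R]_(t in I) g n t)%E =
    (\int[@lebesgue_measure R]_(t in I) (M - ln (trig A a b 1 t + @harmonic R n)))%:E.
    rewrite /Rintegral fineK// integrable_fin_num//.
    apply: continuous_integrable_itv => t; apply: cvgB; first exact: cvg_cst.
    exact: cg.
  rewrite lee_fin RintegralB//; last 2 first.
  - by apply: continuous_integrable_itv => ?; exact: cvg_cst.
  - by apply: continuous_integrable_itv; exact: cg.
  have -> : \int[@lebesgue_measure R]_(t in I) M = M * (2 * pi).
    by transitivity (M * fine (@lebesgue_measure R I)); [exact: Rintegral_cst|rewrite lI].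
  rewrite mulrC gerBl.
  under eq_Rintegral do rewrite trigD.
  by apply: (@integral_ln_trig_ge0 R 1 _ _ _ B) => //; rewrite -?trigD;
    have := h0 n; lra.
have mln : measurable_fun I (fun t => lne (trig A a b 1 t)%:E).
  apply: measurable_lne_comp => //; apply: measurable_funTS.
  by apply: continuous_measurable_fun; exact: continuous_trig.
pose k t := (M%:E - lne (trig A a b 1 t)%:E)%E.
have mk : measurable_fun I k by apply: emeasurable_funB.
have k0 t : I t -> (0 <= k t)%E.
  move=> It; rewrite /k gl; apply: lime_ge; last by apply: nearW => n; exact: g0.
  by apply: ereal_nondecreasing_is_cvgn; exact: ndg.
have ik : (\int[@lebesgue_measure R]_(t in I) k t <= (2 * pi * M)%:E)%E.
  under eq_integral do rewrite /k gl.
  rewrite monotone_convergence//; apply: lime_le; last exact: nearW.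
  apply: ereal_nondecreasing_is_cvgn => m n mn.
  apply: ge0_le_integral => //; try (by move=> t; exact: g0).
  - exact: mg.
  - exact: mg.
  - by move=> t It; exact: ndg.
have intk : (@lebesgue_measure R).-integrable I k.
  apply/integrableP; split => //.
  apply: (le_lt_trans _ (le_lt_trans ik (ltry _))).
  rewrite le_eqVlt; apply/orP; left; apply/eqP; apply: eq_integral => t /set_mem It.
  by rewrite gee0_abs//; exact: k0.
have intM : (@lebesgue_measure R).-integrable I (cst M%:E).
  by apply: continuous_integrable_itv => ?; exact: cvg_cst.
have lk : (fun t => lne (trig A a b 1 t)%:E) = (fun t => (cst M%:E t - k t)%E).
  apply/funext => t; rewrite /k /=; case: ifPn => // _.
  by rewrite -!EFinB; congr EFin; ring.
rewrite lk; split; first exact: integrableB.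
rewrite integralB//.
have -> : (\int[@lebesgue_measure R]_(t in I) cst M%:E t)%E = (2 * pi * M)%:E.
  transitivity (M%:E * @lebesgue_measure R I)%E; first exact: integral_cst.
  by rewrite lI -EFinM mulrC.
by rewrite sube_ge0// integrable_fin_num.
Qed.

(** * Complex numbers as pairs of reals *)

Lemma normc_norm (R : realType) (z : Cplx R) : `|z| = (normc z)%:C%C.
Proof. by []. Qed.

Lemma normc_ge0 (R : realType) (z : Cplx R) : 0 <= normc z.
Proof. by case: z => x y; exact: sqrtr_ge0. Qed.

Lemma ltC_real (R : realType) (x y : R) : (x%:C%C < y%:C%C) = (x < y).
Proof. by rewrite ltcE /= eqxx. Qed.

Lemma gt0C_real (R : realType) (e : R[i]) : 0 < e -> exists2 d : R, 0 < d & e = d%:C%C.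
Proof.
case: e => x y; rewrite ltcE /= => /andP[/eqP -> x0]; by exists x.
Qed.

(** The norm of R[i] takes values in R[i]; this is the description of
neighbourhoods with real radii. *)
Lemma nearC (R : realType) (x : Cplx R) (P : set (Cplx R)) :
  (\forall y \near x, P y) <->
  exists2 e : R, 0 < e & forall y, normc (y - x) < e -> P y.
Proof.
split.
  move=> /nbhs_ballP[e /= /gt0C_real[d d0 ->] dP]; exists d => // y yx.
  by apply: dP; rewrite /ball /= distrC normc_norm ltC_real.
move=> [d d0 dP]; apply/nbhs_ballP; exists d%:C%C => /=; first by rewrite ltC_real.
by move=> y; rewrite /ball /= distrC normc_norm ltC_real; exact: dP.
Qed.

(** The first-order expansion on which the Goursat argument rests. *)
Lemma derivableC (R : realType) (f : Cplx R -> Cplx R) (z : Cplx R) :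
  derivable f z 1 -> exists l : Cplx R, forall e : R, 0 < e ->
  exists2 d : R, 0 < d & forall y : Cplx R, normc (y - z) < d ->
    normc (f y - f z - l * (y - z)) <= e * normc (y - z).
Proof.
move=> /cvg_ex[/= l hl]; exists l => e e0.
move/cvgrPdist_lt : hl => /(_ e%:C%C); rewrite ltC_real => /(_ e0).
move=> /nbhs_ballP[d0 /= /gt0C_real[d d1 ->] dP]; exists d => // y yd.
have [->|yz] := eqVneq y z; first by rewrite !subrr mulr0 subr0 normc0 mulr0.
have yz0 : y - z != 0 by rewrite subr_eq0.
have := dP (y - z); rewrite /ball /= sub0r normrN normc_norm ltC_real => /(_ yd yz0).
rewrite normc_norm ltC_real [(y - z)%R *: 1]mulr1 subrK.
rewrite -[(y - z)^-1 *: _]/((y - z)^-1 * (f y - f z)) => h.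
have -> : f y - f z - l * (y - z) = - ((l - (y - z)^-1 * (f y - f z)) * (y - z)).
  by rewrite mulrBl mulrAC mulVf// mul1r opprB.
by rewrite normcN normcM ler_wpM2r ?normc_ge0// ltW.
Qed.

(** The identification of the plane used by [area_int]. *)
Definition cpl (R : realType) (p : R * R) : Cplx R := (p.1 +i* p.2)%C.

Lemma Re_le_normc (R : realType) (z : Cplx R) : `|complex.Re z| <= normc z.
Proof.
by case: z => x y; rewrite /= -sqrtr_sqr ler_wsqrtr// lerDl sqr_ge0.
Qed.

Lemma Im_le_normc (R : realType) (z : Cplx R) : `|complex.Im z| <= normc z.
Proof.
by case: z => x y; rewrite /= -sqrtr_sqr ler_wsqrtr// lerDr sqr_ge0.
Qed.

Lemma normc_le_ReIm (R : realType) (z : Cplx R) : normc z <= `|complex.Re z| + `|complex.Im z|.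
Proof.
case: z => x y /=; rewrite -(@ler_pXn2r _ 2%N)// ?nnegrE ?sqrtr_ge0 ?addr_ge0//.
rewrite sqr_sqrtr ?addr_ge0 ?sqr_ge0// sqrrD !real_normK ?num_real//.
rewrite -addrA [_ *+ 2 + _]addrC addrA lerDl mulrn_wge0// mulr_ge0//.
Qed.

Lemma normcB (R : realType) (x y : Cplx R) : normc (x - y) = normc (y - x).
Proof. by rewrite -normcN opprB. Qed.

Lemma derivable_continuousC (R : realType) (f : Cplx R -> Cplx R) (z : Cplx R) :
  derivable f z 1 -> forall e : R, 0 < e ->
  exists2 d : R, 0 < d & forall y : Cplx R, normc (y - z) < d ->
    normc (f y - f z) < e.
Proof.
move=> /derivableC[l hl] e e0; have [d d0 hd] := hl 1 ltr01.
pose K := 1 + normc l; have K0 : 0 < K by rewrite ltr_pwDl// normc_ge0.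
exists (Num.min d (e / K)); first by rewrite lt_min d0 divr_gt0.
move=> y; rewrite lt_min => /andP[yd ye].
have : normc (f y - f z) <= K * normc (y - z).
  rewrite -[f y - f z](subrK (l * (y - z))) (le_trans (le_normcD _ _))//.
  by rewrite mulrDl normcM lerD// hd.
by move=> /le_lt_trans; apply; rewrite mulrC -ltr_pdivlMr.
Qed.

Lemma continuous_cpl_comp (R : realType) (g : Cplx R -> R) (p : R * R) :
  (forall e : R, 0 < e -> exists2 d : R, 0 < d &
    forall y : Cplx R, normc (y - cpl p) < d -> `|g y - g (cpl p)| < e) ->
  {for p, continuous (g \o @cpl R)}.
Proof.
move=> h; apply/cvgrPdist_lt => e e0; have [d d0 hd] := h e e0.
have d20 : 0 < d / 2 by rewrite divr_gt0.
apply: filterS (nbhsx_ballx p _ d20) => q [/= h1 h2]; rewrite distrC /=; apply: hd.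
apply: (le_lt_trans (normc_le_ReIm _)) => /=.
move: h1 h2; rewrite /ball /= (distrC p.1) (distrC p.2) => h1 h2.
lra.
Qed.

Lemma holomorphic_continuous (R : realType) (f : Cplx R -> Cplx R) (p : R * R) :
  derivable f (cpl p) 1 ->
  {for p, continuous (fun q => complex.Re (f (cpl q)))} /\
  {for p, continuous (fun q => complex.Im (f (cpl q)))}.
Proof.
move=> df; split; [apply: (@continuous_cpl_comp R (fun z => complex.Re (f z)))|
  apply: (@continuous_cpl_comp R (fun z => complex.Im (f z)))] => e e0;
  have [d d0 hd] := derivable_continuousC df e0; exists d => // y yd;
  apply: le_lt_trans (hd y yd).
- by rewrite -raddfB; exact: Re_le_normc.
- by rewrite -raddfB; exact: Im_le_normc.
Qed.

(** * Polar coordinates *)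

Definition cis (R : realType) (t : R) : Cplx R := (cos t +i* sin t)%C.

Lemma normc_cis (R : realType) (t : R) : normc (cis t) = 1.
Proof. by rewrite /normc /cis cos2Dsin2 sqrtr1. Qed.

(** The point z scaled by r and rotated by t, for a fixed z. *)
Definition ray (R : realType) (z : Cplx R) (r t : R) : Cplx R :=
  (r%:C)%C * (z * cis t).

Lemma Re_mulC (R : realType) (z w : Cplx R) :
  complex.Re (z * w) = complex.Re z * complex.Re w - complex.Im z * complex.Im w.
Proof. by case: z; case: w. Qed.

Lemma Im_mulC (R : realType) (z w : Cplx R) :
  complex.Im (z * w) = complex.Re z * complex.Im w + complex.Im z * complex.Re w.
Proof. by case: z; case: w. Qed.

Lemma rayE (R : realType) (z : Cplx R) (r t : R) : ray z r t =
  cpl (r * (complex.Re z * cos t - complex.Im z * sin t),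
       r * (complex.Re z * sin t + complex.Im z * cos t)).
Proof.
by rewrite /ray /cpl /cis; case: z => x y; apply/eqP; rewrite eq_complex /=;
  apply/andP; split; apply/eqP; ring.
Qed.

Lemma normc_real (R : realType) (r : R) : normc (r%:C%C : Cplx R) = `|r|.
Proof. by rewrite /normc /= expr0n addr0 sqrtr_sqr. Qed.

Lemma normc_ray (R : realType) (z : Cplx R) (r t : R) :
  normc (ray z r t) = `|r| * normc z.
Proof. by rewrite /ray !normcM normc_cis mulr1 normc_real. Qed.

(** Mean value theorem for the cosine and the sine separately. *)
Lemma cis_lipschitz (R : realType) (s t : R) :
  normc (cis t - cis s) <= 2 * `|t - s|.
Proof.
wlog st : s t / s <= t => [hw|].
  by have [/hw//|/ltW/hw] := leP s t; rewrite normcB distrC.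
apply: (le_trans (normc_le_ReIm _)); rewrite mulrDl mul1r.
have cc : {within `[s, t], continuous (@cos R)}.
  by apply: continuous_subspaceT; exact: continuous_cos.
have cs : {within `[s, t], continuous (@sin R)}.
  by apply: continuous_subspaceT; exact: continuous_sin.
apply: lerD.
- have [c _ /= ->] := @MVT_segment R cos (fun x => - sin x) s t st
    (fun x _ => is_derive_cos x) cc.
  rewrite normrM ler_piMl// normrN ler_norml sin_geN1 sin_le1//.
- have [c _ /= ->] := @MVT_segment R sin cos s t st
    (fun x _ => is_derive_sin x) cs.
  rewrite normrM ler_piMl// ler_norml cos_geN1 cos_le1//.
Qed.

Lemma ray_lipschitz (R : realType) (z : Cplx R) (r t r0 t0 : R) :
  normc z <= 1 -> 0 <= r0 <= 1 ->
  normc (ray z r t - ray z r0 t0) <= `|r - r0| + 2 * `|t - t0|.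
Proof.
move=> z1 /andP[r00 r01].
have -> : ray z r t - ray z r0 t0 =
    z * ((r - r0)%:C%C * cis t + r0%:C%C * (cis t - cis t0)).
  rewrite /ray rmorphB /=; ring.
rewrite normcM -[leRHS]mul1r ler_pM ?normc_ge0//.
apply: (le_trans (le_normcD _ _)); rewrite !normcM normc_cis mulr1 !normc_real.
apply: lerD => //; rewrite -[leRHS]mul1r ler_pM ?normc_ge0 ?cis_lipschitz//.
by rewrite ger0_norm.
Qed.

(** Continuity on the open unit disc, stated for the two real components as
functions on the plane. *)
Definition disc_cont (R : realType) (f : Cplx R -> Cplx R) :=
  forall p : R * R, normc (cpl p) < 1 ->
  {for p, continuous (fun q => complex.Re (f (cpl q)))} /\
  {for p, continuous (fun q => complex.Im (f (cpl q)))}.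

Lemma ray_continuous_t (R : realType) (z : Cplx R) (r t : R) (h : R * R -> R) :
  {for (r * (complex.Re z * cos t - complex.Im z * sin t),
        r * (complex.Re z * sin t + complex.Im z * cos t)), continuous h} ->
  {for t, continuous (fun s => h
     (r * (complex.Re z * cos s - complex.Im z * sin s),
      r * (complex.Re z * sin s + complex.Im z * cos s)))}.
Proof.
move=> ch.
have c1 : r * (complex.Re z * cos s - complex.Im z * sin s) @[s --> t] -->
          r * (complex.Re z * cos t - complex.Im z * sin t).
  by apply: cvgMr; apply: cvgB; apply: cvgMr; [exact: continuous_cos|exact: continuous_sin].
have c2 : r * (complex.Re z * sin s + complex.Im z * cos s) @[s --> t] -->
          r * (complex.Re z * sin t + complex.Im z * cos t).
  by apply: cvgMr; apply: cvgD; apply: cvgMr; [exact: continuous_sin|exact: continuous_cos].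
exact: cvg_comp (cvg_pair c1 c2) ch.
Qed.

Lemma ray_continuous_r (R : realType) (a b r : R) (h : R * R -> R) :
  {for (r * a, r * b), continuous h} ->
  {for r, continuous (fun s : R => h (s * a, s * b))}.
Proof.
move=> ch.
have c1 : s * a @[s --> r] --> r * a by apply: cvgMl; exact: cvg_id.
have c2 : s * b @[s --> r] --> r * b by apply: cvgMl; exact: cvg_id.
exact: cvg_comp (cvg_pair c1 c2) ch.
Qed.

(** * Integrals along the boundary of a polar rectangle *)

Definition Jint (R : realType) (g : R -> R) (a b : R) : R :=
  \int[@lebesgue_measure R]_(x in `[a, b]) g x.

Lemma cont_in_integrable (R : realType) (a b : R) (g : R -> R) :
  (forall x, a <= x <= b -> {for x, continuous g}) ->
  (@lebesgue_measure R).-integrable `[a, b] (EFin \o g).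
Proof.
move=> cg; apply: continuous_compact_integrable; first exact: segment_compact.
by apply: continuous_in_subspaceT => x; rewrite inE /= in_itv /=; exact: cg.
Qed.

Lemma Jint_split (R : realType) (a m b : R) (g : R -> R) : a <= m <= b ->
  (forall x, a <= x <= b -> {for x, continuous g}) ->
  Jint g a b = Jint g a m + Jint g m b.
Proof.
move=> /andP[am mb] cg; rewrite /Jint.
have ig := cont_in_integrable cg.
have h := @Rintegral_itvB R g (BLeft a) (BRight b) m ig.
apply/eqP; rewrite addrC -subr_eq; apply/eqP; rewrite h ?bnd_simp//.
rewrite Rintegral_itv_obnd_cbnd//; apply: integrableS ig => //.
by apply: subset_itvr; rewrite bnd_simp.
Qed.

Lemma Jint_bound (R : realType) (a b K : R) (g : R -> R) : a <= b ->
  (forall x, a <= x <= b -> {for x, continuous g}) ->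
  (forall x, a <= x <= b -> `|g x| <= K) ->
  `|Jint g a b| <= K * (b - a).
Proof.
move=> ab cg gK; have ig := cont_in_integrable cg.
apply: (le_trans (le_normr_Rintegral _ ig)) => //.
have -> : K * (b - a) = \int[@lebesgue_measure R]_(x in `[a, b]) K.
  transitivity (K * fine (@lebesgue_measure R `[a, b]%classic)).
    rewrite lebesgue_measure_itv /= lte_fin; case: ltP => // ba.
    by have -> : a = b by [apply/eqP; rewrite eq_le ab]; rewrite subrr.
  by rewrite Rintegral_cst.
apply: le_Rintegral => //.
- by apply: cont_in_integrable => x /cg h; apply: (continuous_comp h); exact: norm_continuous.
- by apply: cont_in_integrable => x _; exact: cvg_cst.
Qed.

Lemma JintB (R : realType) (a b : R) (g h : R -> R) :
  (forall x, a <= x <= b -> {for x, continuous g}) ->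
  (forall x, a <= x <= b -> {for x, continuous h}) ->
  Jint (fun x => g x - h x) a b = Jint g a b - Jint h a b.
Proof. by move=> cg ch; apply: RintegralB => //; exact: cont_in_integrable. Qed.

(** The real part of the integral of f(w) dw / (i w), for z <> 0 and w = r z
e^(it), along the boundary of the polar rectangle a <= r <= b, c <= t <= d. It
vanishes for f holomorphic, as the integrand is then closed away from w = 0.
*)
Definition rect_int (R : realType) (f : Cplx R -> Cplx R) (z : Cplx R)
    (a b c d : R) : R :=
  Jint (fun r => complex.Im (f (ray z r c)) / r) a b -
  Jint (fun r => complex.Im (f (ray z r d)) / r) a b +
  Jint (fun t => complex.Re (f (ray z b t))) c d -
  Jint (fun t => complex.Re (f (ray z a t))) c d.

Section disc_cont_rays.
Context {R : realType} (z : Cplx R) (z1 : normc z < 1).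

Lemma ray_in_disc (r t : R) : 0 <= r <= 1 -> normc (ray z r t) < 1.
Proof.
move=> /andP[r0 r1]; rewrite normc_ray ger0_norm//.
by rewrite (le_lt_trans _ z1)// ler_piMl ?normc_ge0.
Qed.

Lemma disc_cont_t (f : Cplx R -> Cplx R) (r : R) : disc_cont f -> 0 <= r <= 1 ->
  continuous (fun t => complex.Re (f (ray z r t))).
Proof.
move=> cf r01 t; under eq_fun do rewrite rayE.
apply: (@ray_continuous_t _ z r t (fun q => complex.Re (f (cpl q)))).
by apply: (cf _ _).1; rewrite -rayE ray_in_disc.
Qed.

Lemma disc_cont_r (f : Cplx R -> Cplx R) (r t : R) : disc_cont f -> 0 < r <= 1 ->
  {for r, continuous (fun s => complex.Im (f (ray z s t)) / s)}.
Proof.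
move=> cf /andP[r0 r1].
apply: cvgM; last by apply: cvgV; [rewrite gt_eqF|exact: cvg_id].
have : {for r, continuous (fun s => complex.Im (f (ray z s t)))}; last by [].
rewrite (_ : (fun s => complex.Im (f (ray z s t))) = fun s : R => complex.Im (f (cpl
  (s * (complex.Re z * cos t - complex.Im z * sin t),
   s * (complex.Re z * sin t + complex.Im z * cos t))))); last first.
  by apply/funext => s; rewrite rayE.
apply: (@ray_continuous_r _ _ _ r (fun q => complex.Im (f (cpl q)))).
by apply: (cf _ _).2; rewrite -rayE ray_in_disc// ltW.
Qed.

Lemma rect_int_splitr (f : Cplx R -> Cplx R) (a m b c d : R) : disc_cont f ->
  0 < a -> a <= m <= b -> b <= 1 ->
  rect_int f z a b c d = rect_int f z a m c d + rect_int f z m b c d.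
Proof.
move=> cf a0 /andP[am mb] b1; rewrite /rect_int.
rewrite !(@Jint_split _ a m b) ?am//; last 2 first.
- by move=> x /andP[ax xb]; apply: disc_cont_r => //; apply/andP; split; lra.
- by move=> x /andP[ax xb]; apply: disc_cont_r => //; apply/andP; split; lra.
by ring.
Qed.

Lemma rect_int_splitt (f : Cplx R -> Cplx R) (a b c m d : R) : disc_cont f ->
  0 <= a <= 1 -> 0 <= b <= 1 -> c <= m <= d ->
  rect_int f z a b c d = rect_int f z a b c m + rect_int f z a b m d.
Proof.
move=> cf a01 b01 cmd; rewrite /rect_int.
rewrite !(@Jint_split _ c m d)//; last 2 first.
- by move=> x _; exact: disc_cont_t.
- by move=> x _; exact: disc_cont_t.
by ring.
Qed.

Lemma rect_intB (f g : Cplx R -> Cplx R) (a b c d : R) :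
  disc_cont f -> disc_cont g -> 0 < a -> a <= b -> b <= 1 ->
  rect_int (fun w => f w - g w) z a b c d = rect_int f z a b c d - rect_int g z a b c d.
Proof.
move=> cf cg a0 ab b1; rewrite /rect_int.
have hr t x : a <= x <= b -> 0 < x <= 1.
  by move=> /andP[ax xb]; apply/andP; split; lra.
have rr h : disc_cont h -> forall t x, a <= x <= b ->
    {for x, continuous (fun s => complex.Im (h (ray z s t)) / s)}.
  by move=> ch t x xab; apply: disc_cont_r => //; exact: hr t x xab.
have ea t : Jint (fun r => complex.Im (f (ray z r t) - g (ray z r t)) / r) a b =
  Jint (fun r => complex.Im (f (ray z r t)) / r) a b -
  Jint (fun r => complex.Im (g (ray z r t)) / r) a b.
  rewrite -JintB; [|exact: rr|exact: rr].
  by apply: eq_Rintegral => x _; rewrite raddfB /= mulrBl.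
have eb s : 0 <= s <= 1 -> Jint (fun t => complex.Re (f (ray z s t) - g (ray z s t))) c d =
  Jint (fun t => complex.Re (f (ray z s t))) c d -
  Jint (fun t => complex.Re (g (ray z s t))) c d.
  move=> s01; rewrite -JintB; last 2 first.
  - by move=> x _; exact: disc_cont_t.
  - by move=> x _; exact: disc_cont_t.
  by apply: eq_Rintegral => x _; rewrite raddfB.
rewrite !ea !eb; first by ring.
- by apply/andP; split; lra.
- by apply/andP; split; lra.
Qed.

(** Each of the four integrands is at most K / a in absolute value, since a <=
1. *)
Lemma rect_int_bound (f : Cplx R -> Cplx R) (a b c d K : R) :
  disc_cont f -> 0 < a -> a <= b -> b <= 1 -> c <= d ->
  (forall r t, a <= r <= b -> c <= t <= d -> normc (f (ray z r t)) <= K) ->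
  `|rect_int f z a b c d| <= 2 / a * K * ((b - a) + (d - c)).
Proof.
move=> cf a0 ab b1 cd fK.
have K0 : 0 <= K.
  by apply: le_trans (fK a c _ _); rewrite ?normc_ge0// !lexx /= ?ab ?cd.
have a1 : 1 <= a^-1 by rewrite invf_ge1//; lra.
have cc : c <= c <= d by rewrite lexx.
have dd : c <= d <= d by rewrite lexx andbT.
have hP t : c <= t <= d ->
    `|Jint (fun r => complex.Im (f (ray z r t)) / r) a b| <= K / a * (b - a).
  move=> tcd; apply: Jint_bound => // x xab.
    by apply: disc_cont_r => //; case/andP: xab => ? ?; apply/andP; split; lra.
  case/andP: (xab) => ax xb; have x0 : 0 < x by lra.
  rewrite normrM ler_pM ?normr_ge0//.
    by apply: (le_trans (Im_le_normc _)); exact: fK.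
  by rewrite gtr0_norm ?invr_gt0// lef_pV2.
have hQ r : a <= r <= b ->
    `|Jint (fun t => complex.Re (f (ray z r t))) c d| <= K / a * (d - c).
  move=> /andP[ar rb]; apply: Jint_bound => // x xcd.
    by apply: disc_cont_t => //; apply/andP; split; lra.
  apply: (le_trans (Re_le_normc _)).
  apply: (le_trans (fK _ _ _ xcd)); first by rewrite ar.
  by rewrite ler_peMr.
have := hP c cc; have := hP d dd; have := hQ a ltac:(by rewrite lexx).
have := hQ b ltac:(by rewrite lexx andbT).
rewrite /rect_int; move: (Jint _ _ _) (Jint _ _ _) (Jint _ _ _) (Jint _ _ _).
move=> q1 q2 q3 q4.
rewrite !ler_norml => /andP[? ?] /andP[? ?] /andP[? ?] /andP[? ?].
have -> : 2 / a * K * (b - a + (d - c)) = 2 * (K / a * (b - a)) + 2 * (K / a * (d - c)).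
  by ring.
by apply/andP; split; lra.
Qed.

End disc_cont_rays.
(** * Goursat's theorem for polar rectangles *)

(** One of the four pieces carries at least a quarter of the absolute value of
the sum. *)
Lemma rect_quarter (R : realType) (F : R -> R -> R -> R -> R) (x y h k M : R) :
  F x (x + (h + h)) y (y + (k + k)) =
    (F x (x + h) y (y + k) + F x (x + h) (y + k) (y + k + k)) +
    (F (x + h) (x + h + h) y (y + k) + F (x + h) (x + h + h) (y + k) (y + k + k)) ->
  M <= `|F x (x + (h + h)) y (y + (k + k))| -> 0 <= h -> 0 <= k ->
  exists x' y', [/\ x <= x' <= x + h, y <= y' <= y + k &
    M / 4 <= `|F x' (x' + h) y' (y' + k)|].
Proof.
move=> eF MF h0 k0.
have ux : x <= x <= x + h by rewrite lexx lerDl.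
have ux' : x <= x + h <= x + h by rewrite lexx lerDl h0.
have uy : y <= y <= y + k by rewrite lexx lerDl.
have uy' : y <= y + k <= y + k by rewrite lexx lerDl k0.
have [s1|s1] := leP (M / 4) `|F x (x + h) y (y + k)|; first by exists x, y.
have [s2|s2] := leP (M / 4) `|F x (x + h) (y + k) (y + k + k)|.
  by exists x, (y + k).
have [s3|s3] := leP (M / 4) `|F (x + h) (x + h + h) y (y + k)|.
  by exists (x + h), y.
have [s4|s4] := leP (M / 4) `|F (x + h) (x + h + h) (y + k) (y + k + k)|.
  by exists (x + h), (y + k).
have n4 (p q r s : R) : `|(p + q) + (r + s)| <= `|p| + `|q| + `|r| + `|s|.
  by rewrite -[leRHS]addrA (le_trans (ler_normD _ _))// lerD ?ler_normD.
have := le_trans MF _; rewrite eF => /(_ _ (n4 _ _ _ _)).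
move: s1 s2 s3 s4; clear; lra.
Qed.

(** An additive function of rectangles that is locally small compared with the
square of the size vanishes. Otherwise successive quadrisection gives nested
rectangles on which the absolute value is at least 4^-n times the initial one,
while their sizes are 2^-n times the initial one; at their common point this
contradicts the local bound. *)
Lemma rect_quadrisection (R : realType) (F : R -> R -> R -> R -> R) (a0 b0 c0 d0 : R) :
  a0 <= b0 -> c0 <= d0 ->
  (forall a m b c d, a0 <= a -> a <= m <= b -> b <= b0 -> c0 <= c -> c <= d -> d <= d0 ->
     F a b c d = F a m c d + F m b c d) ->
  (forall a b c m d, a0 <= a -> a <= b -> b <= b0 -> c0 <= c -> c <= m <= d -> d <= d0 ->
     F a b c d = F a b c m + F a b m d) ->
  (forall r t e, a0 <= r <= b0 -> c0 <= t <= d0 -> 0 < e ->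
     exists2 del, 0 < del & forall a b c d,
       a0 <= a -> a <= r <= b -> b <= b0 -> c0 <= c -> c <= t <= d -> d <= d0 ->
       b - a < del -> d - c < del ->
       `|F a b c d| <= e * ((b - a) + (d - c)) ^+ 2) ->
  F a0 b0 c0 d0 = 0.
Proof.
move=> ab cd splitr splitt loc.
pose H n := (b0 - a0) / 2 ^+ n; pose K n := (d0 - c0) / 2 ^+ n.
have H0 n : 0 <= H n by rewrite divr_ge0 ?subr_ge0// exprn_ge0.
have K0 n : 0 <= K n by rewrite divr_ge0 ?subr_ge0// exprn_ge0.
have HS n : H n = H n.+1 + H n.+1.
  rewrite /H exprS; field; by rewrite expf_neq0.
have KS n : K n = K n.+1 + K n.+1.
  rewrite /K exprS; field; by rewrite expf_neq0.
pose N := `|F a0 b0 c0 d0|.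
pose bad n (p : R * R) := [/\ a0 <= p.1, p.1 + H n <= b0, c0 <= p.2, p.2 + K n <= d0 &
  N / 4 ^+ n <= `|F p.1 (p.1 + H n) p.2 (p.2 + K n)|].
have step n (p : {p | bad n p}) : {q : {q | bad n.+1 q} |
    [/\ (sval p).1 <= (sval q).1, (sval q).1 + H n.+1 <= (sval p).1 + H n,
        (sval p).2 <= (sval q).2 & (sval q).2 + K n.+1 <= (sval p).2 + K n]}.
  apply: cid; case: p => -[x y] [/= ax xb cy yd].
  rewrite HS KS in xb yd *; have h0 := H0 n.+1; have k0 := K0 n.+1.
  set h := H n.+1 in xb h0 *; set k := K n.+1 in yd k0 *.
  have xh : x <= x + h <= x + (h + h) by rewrite lerDl h0 addrA lerDl.
  have yk : y <= y + k <= y + (k + k) by rewrite lerDl k0 addrA lerDl.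
  have [/andP[xh1 xh2] /andP[yk1 yk2]] := conj xh yk.
  have ykk := le_trans yk1 yk2; have xb' := le_trans xh2 xb.
  have ax' := le_trans ax xh1.
  move=> /rect_quarter[] //.
  - by rewrite (splitr x (x + h))// (splitt x _ y (y + k))//
      (splitt (x + h) _ y (y + k))// !addrA.
  move=> x' [y'] [/andP[x1 x2] /andP[y1 y2] hF].
  have hx : x' + h <= x + (h + h) by rewrite addrA lerD2r.
  have ky : y' + k <= y + (k + k) by rewrite addrA lerD2r.
  have bq : bad n.+1 (x', y').
    split; rewrite /= -/h -/k; [exact: le_trans ax x1|exact: le_trans hx xb|
      exact: le_trans cy y1|exact: le_trans ky yd|].
    by rewrite exprSr invfM mulrA.
  by exists (exist _ (x', y') bq).
have bad0 : bad 0%N (a0, c0).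
  have a1 : a0 + H 0%N = b0 by rewrite /H expr0 divr1 addrC subrK.
  have c1 : c0 + K 0%N = d0 by rewrite /K expr0 divr1 addrC subrK.
  by rewrite /bad /= a1 c1 expr0 divr1.
(* The sequence of nested rectangles, by dependent choice. *)
pose s := fix s n : {p | bad n p} :=
  if n is m.+1 then sval (step m (s m)) else exist _ (a0, c0) bad0.
pose X n := (sval (s n)).1; pose Y n := (sval (s n)).2.
have nest n : [/\ X n <= X n.+1, X n.+1 + H n.+1 <= X n + H n, Y n <= Y n.+1 &
    Y n.+1 + K n.+1 <= Y n + K n].
  exact: (svalP (step n (s n))).
have badn n : bad n (X n, Y n) by have := svalP (s n); rewrite /X /Y; case: (sval _).
have ndX : nondecreasing_seq X by apply/nondecreasing_seqP => n; case: (nest n).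
have ndY : nondecreasing_seq Y by apply/nondecreasing_seqP => n; case: (nest n).
have niX : nonincreasing_seq (fun n => X n + H n).
  by apply/nonincreasing_seqP => n; case: (nest n).
have niY : nonincreasing_seq (fun n => Y n + K n).
  by apply/nonincreasing_seqP => n; case: (nest n).
have XU m n : X m <= X n + H n.
  apply: (@le_trans _ _ (X (maxn m n))); first by rewrite ndX// leq_maxl.
  apply: (@le_trans _ _ (X (maxn m n) + H (maxn m n))); first by rewrite lerDl.
  by apply: niX; exact: leq_maxr.
have YU m n : Y m <= Y n + K n.
  apply: (@le_trans _ _ (Y (maxn m n))); first by rewrite ndY// leq_maxl.
  apply: (@le_trans _ _ (Y (maxn m n) + K (maxn m n))); first by rewrite lerDl.
  by apply: niY; exact: leq_maxr.
have supP (Z W : nat -> R) : (forall m n, Z m <= W n) ->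
    exists r, forall n, Z n <= r <= W n.
  move=> ZW; exists (sup (range Z)) => n; apply/andP; split.
    by apply: ub_le_sup; [exists (W 0%N) => _ [m _ <-]|exists n].
  by apply: ge_sup; [exists (Z 0%N); exists 0%N|move=> _ [m _ <-]].
have [r rP] := supP _ _ XU; have [t tP] := supP _ _ YU.
have rab : a0 <= r <= b0.
  have [/= h1 h2 _ _ _] := badn 0%N; case/andP: (rP 0%N) => h3 h4.
  by rewrite (le_trans h1 h3) (le_trans h4 h2).
have tcd : c0 <= t <= d0.
  have [/= _ _ h1 h2 _] := badn 0%N; case/andP: (tP 0%N) => h3 h4.
  by rewrite (le_trans h1 h3) (le_trans h4 h2).
pose L := (b0 - a0) + (d0 - c0).
have key e : 0 < e -> N <= e * L ^+ 2.
  move=> e0; have [del del0 hdel] := loc r t e rab tcd e0.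
  have [n hn] : exists n, H n < del /\ K n < del.
    pose n := Num.bound (L / del); exists n.
    have L0 : 0 <= L by rewrite addr_ge0 ?subr_ge0.
    have : L / del < n%:R by apply: archi_boundP; rewrite divr_ge0// ltW.
    have n2 : (n%:R : R) <= 2 ^+ n by rewrite -natrX ler_nat ltnW// ltn_expl.
    move=> /lt_le_trans /(_ n2); rewrite ltr_pdivrMr// => hL.
    have p2 : (0 : R) < 2 ^+ n by rewrite exprn_gt0.
    by split; rewrite ltr_pdivrMr// mulrC (le_lt_trans _ hL)// /L ?lerDl ?lerDr subr_ge0.
  have [/= h1 h2 h3 h4 h5] := badn n.
  have := hdel _ _ _ _ h1 (rP n) h2 h3 (tP n) h4.
  rewrite ![_ + _ - _]addrAC !subrr !add0r => /(_ hn.1 hn.2) hF.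
  have -> : e * L ^+ 2 = 4 ^+ n * (e * (H n + K n) ^+ 2).
    rewrite /H /K -mulrDl -/L exprMn exprVn -exprM mulnC exprM.
    have -> : (2 : R) ^+ 2 = 4 by ring.
    by field; rewrite expf_neq0.
  by rewrite -ler_pdivrMl ?exprn_gt0// mulrC (le_trans h5).
apply/normr0_eq0/eqP; rewrite eq_le normr_ge0 andbT -/N leNgt; apply/negP => N0.
have L20 : 0 <= L ^+ 2 by exact: sqr_ge0.
(* With this value of e, e L^2 < N. *)
have e0 : 0 < N / (2 * (L ^+ 2 + 1)) by rewrite divr_gt0// mulr_gt0// ltr_wpDl.
have := key _ e0; apply/negP; rewrite -ltNge.
have L1 : 0 < 2 * (L ^+ 2 + 1) by rewrite mulr_gt0// ltr_wpDl.
rewrite -mulrA gtr_pMr// ltr_pdivrMl// mulr1.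
by move: L20; clear; lra.
Qed.

(** Fundamental theorem of calculus. *)
Lemma integral_cos_sin (R : realType) (al be c d : R) : c <= d ->
  Jint (fun t => al * cos t - be * sin t) c d =
  (al * sin d + be * cos d) - (al * sin c + be * cos c).
Proof.
rewrite le_eqVlt => /predU1P[->|cd].
  by rewrite subrr /Jint set_itv1 Rintegral_set1.
pose F (t : R) := al * sin t + be * cos t.
pose f (t : R) := al * cos t - be * sin t.
have dF (t : R) : is_derive t 1 F (f t).
  have := is_deriveD (is_deriveZ al (is_derive_sin t)) (is_deriveZ be (is_derive_cos t)).
  by rewrite /f -mulrN.
have cF : continuous F.
  by move=> t; apply: cvgD; apply: cvgMr; [exact: continuous_sin|exact: continuous_cos].
have cf : continuous f.
  by move=> t; apply: cvgB; apply: cvgMr; [exact: continuous_cos|exact: continuous_sin].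
rewrite /Jint /Rintegral (@continuous_FTC2 _ f F c d cd)//.
- exact: continuous_subspaceT.
- split.
  + by move=> x _; case: (dF x).
  + by apply: cvg_at_right_filter; exact: cF.
  + by apply: cvg_at_left_filter; exact: cF.
- by move=> x _; rewrite derive1E; case: (dF x).
Qed.

Lemma Jint_cst (R : realType) (K c d : R) : c <= d -> Jint (fun=> K) c d = K * (d - c).
Proof.
move=> cd; transitivity (K * fine (@lebesgue_measure R `[c, d]%classic)).
  exact: Rintegral_cst.
rewrite lebesgue_measure_itv /= lte_fin; case: ltP => // dc.
by have -> : c = d by [apply/eqP; rewrite eq_le cd]; rewrite subrr.
Qed.

Lemma lipschitz_disc_cont (R : realType) (g : Cplx R -> Cplx R) (K : R) :
  (forall x y, normc (g x - g y) <= K * normc (x - y)) -> disc_cont g.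
Proof.
move=> gK p _.
have h e : 0 < e -> exists2 d : R, 0 < d & forall y : Cplx R,
    normc (y - cpl p) < d -> normc (g y - g (cpl p)) < e.
  move=> e0; exists (e / (`|K| + 1)); first by rewrite divr_gt0// ltr_pwDr.
  move=> y; rewrite ltr_pdivlMr ?ltr_pwDr// => hy.
  apply: (le_lt_trans (gK _ _)); apply: le_lt_trans hy.
  rewrite mulrC ler_wpM2l ?normc_ge0//.
  by rewrite (le_trans (ler_norm _))// lerDl.
split; [apply: (@continuous_cpl_comp R (fun z => complex.Re (g z)))|
  apply: (@continuous_cpl_comp R (fun z => complex.Im (g z)))] => e e0;
  have [d d0 hd] := h e e0; exists d => // y yd; apply: le_lt_trans (hd y yd).
- by rewrite -raddfB; exact: Re_le_normc.
- by rewrite -raddfB; exact: Im_le_normc.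
Qed.

Lemma disc_cont_affine (R : realType) (w l : Cplx R) :
  disc_cont (fun x : Cplx R => w + l * x).
Proof.
apply: (@lipschitz_disc_cont _ _ (normc l)) => x y.
by rewrite opprD addrACA subrr add0r -mulrBr normcM.
Qed.

Lemma ReDZ (R : realType) (w v : Cplx R) (s : R) :
  complex.Re (w + s%:C%C * v) = complex.Re w + s * complex.Re v.
Proof. by case: w => ? ?; case: v => ? ? /=; ring. Qed.

Lemma ImDZ (R : realType) (w v : Cplx R) (s : R) :
  complex.Im (w + s%:C%C * v) = complex.Im w + s * complex.Im v.
Proof. by case: w => ? ?; case: v => ? ? /=; ring. Qed.

(** Direct computation: the constant w contributes opposite values on opposite
sides, and for the linear part both pairs of sides are integrated explicitly.
*)
Lemma rect_int_affine (R : realType) (z w l : Cplx R) (a b c d : R) :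
  normc z < 1 -> 0 < a -> a <= b -> b <= 1 -> c <= d ->
  rect_int (fun x => w + l * x) z a b c d = 0.
Proof.
move=> z1 a0 ab b1 cd; pose lz := l * z.
have cA := disc_cont_affine w l.
have cr t x : a <= x <= b ->
    {for x, continuous (fun s => complex.Im (w + l * ray z s t) / s)}.
  move=> /andP[ax xb]; have x01 : 0 < x <= 1 by rewrite (lt_le_trans a0 ax) (le_trans xb b1).
  exact: (@disc_cont_r R z z1 _ x t cA x01).
have ct s : 0 <= s <= 1 -> forall x, c <= x <= d ->
    {for x, continuous (fun t => complex.Re (w + l * ray z s t))}.
  by move=> s01 x _; exact: (disc_cont_t z1 cA s01).
have ea s t : w + l * ray z s t = w + s%:C%C * (lz * cis t).
  by rewrite /ray /lz; ring.
have I1 : Jint (fun r => complex.Im (w + l * ray z r c) / r) a b -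
    Jint (fun r => complex.Im (w + l * ray z r d) / r) a b =
    (complex.Im (lz * cis c) - complex.Im (lz * cis d)) * (b - a).
  rewrite -(JintB (cr c) (cr d)) -Jint_cst//; apply: eq_Rintegral => x.
  rewrite inE /= in_itv /= => /andP[ax xb].
  have x0 : x != 0 by rewrite gt_eqF// (lt_le_trans a0).
  by rewrite !ea !ImDZ; field.
have I2 : Jint (fun t => complex.Re (w + l * ray z b t)) c d -
    Jint (fun t => complex.Re (w + l * ray z a t)) c d =
    ((b - a) * complex.Re lz * sin d + (b - a) * complex.Im lz * cos d) -
    ((b - a) * complex.Re lz * sin c + (b - a) * complex.Im lz * cos c).
  rewrite -JintB; last 2 first.
  - by apply: ct; rewrite b1 (le_trans (ltW a0)).
  - by apply: ct; rewrite (ltW a0) (le_trans ab).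
  rewrite -integral_cos_sin//; apply: eq_Rintegral => x _.
  by rewrite !ea !ReDZ Re_mulC /=; ring.
rewrite /rect_int -addrA I1 I2 !Im_mulC /=; ring.
Qed.

Lemma holo_disc_cont (R : realType) (f : Cplx R -> Cplx R) :
  holomorphic_on (unit_disc R) f -> disc_cont f.
Proof. by move=> hf p p1; apply: holomorphic_continuous; exact: hf. Qed.

(** The hypothesis of [rect_quadrisection] holds at a point z0 since f differs
from its affine expansion there by o(|w - z0|), and affine functions
contribute nothing. *)
Lemma goursat_ray (R : realType) (f : Cplx R -> Cplx R) (z : Cplx R) (a0 c0 d0 : R) :
  holomorphic_on (unit_disc R) f -> normc z < 1 -> 0 < a0 <= 1 -> c0 <= d0 ->
  rect_int f z a0 1 c0 d0 = 0.
Proof.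
move=> hf z1 /andP[a00 a01] cd0; have cf := holo_disc_cont hf.
apply: (rect_quadrisection a01 cd0).
- move=> a m b c d aa amb b1 _ _ _; apply: rect_int_splitr => //.
  exact: lt_le_trans aa.
- move=> a b c m d aa ab b1 _ cmd _; have a_gt0 := lt_le_trans a00 aa.
  apply: rect_int_splitt => //; first by rewrite (ltW a_gt0) (le_trans ab).
  by rewrite b1 (le_trans (ltW a_gt0)).
move=> r0 t0 e /andP[ar0 r01] _ e0.
have r00 := lt_le_trans a00 ar0.
have r001 : 0 <= r0 <= 1 by rewrite r01 ltW.
pose z0 := ray z r0 t0.
have z0D : unit_disc R z0 by exact: ray_in_disc.
have [l hl] := derivableC (hf _ z0D).
(* 2 / a * (e' * 2 D) * D <= e D^2 for a0 <= a, where D is the sum of the sides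
   of the rectangle; its points are within 2 D of z0, hence the bound del / 5. *)
pose e' := e * a0 / 4.
have e'0 : 0 < e' by rewrite divr_gt0// mulr_gt0.
have [del del0 hdel] := hl e' e'0.
exists (del / 5); first by rewrite divr_gt0.
move=> a b c d aa /andP[ar rb] b1 _ /andP[ct td] _ hab hcd.
have a_gt0 := lt_le_trans a00 aa.
have ab := le_trans ar rb; have cd := le_trans ct td.
pose A (x : Cplx R) : Cplx R := (f z0 - l * z0) + l * x.
have cA : disc_cont A by exact: disc_cont_affine.
have -> : rect_int f z a b c d = rect_int (fun w => f w - A w) z a b c d.
  by rewrite rect_intB// (rect_int_affine (f z0 - l * z0) l z1 a_gt0 ab b1 cd) subr0.
pose D := (b - a) + (d - c).
have cE : disc_cont (fun w => f w - A w).
  move=> p p1; have [f1 f2] := cf p p1; have [g1 g2] := cA p p1.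
  split.
    rewrite (_ : (fun q => _) = (fun q => complex.Re (f (cpl q)) - complex.Re (A (cpl q)))).
      exact: cvgB.
    by apply/funext => q; rewrite raddfB.
  rewrite (_ : (fun q => _) = (fun q => complex.Im (f (cpl q)) - complex.Im (A (cpl q)))).
    exact: cvgB.
  by apply/funext => q; rewrite raddfB.
have hE r t : a <= r <= b -> c <= t <= d ->
    normc (f (ray z r t) - A (ray z r t)) <= e' * (2 * D).
  move=> /andP[ar' rb'] /andP[ct' td'].
  have hd : normc (ray z r t - z0) <= 2 * D.
    apply: (le_trans (ray_lipschitz _ _ _ (ltW z1) r001)).
    have h1 : `|r - r0| <= b - a by rewrite ler_norml; apply/andP; split; lra.
    have h2 : `|t - t0| <= d - c by rewrite ler_norml; apply/andP; split; lra.
    by rewrite /D; move: h1 h2 ab; clear; lra.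
  have hd' : normc (ray z r t - z0) < del.
    by apply: (le_lt_trans hd); rewrite /D; move: hab hcd del0; clear; lra.
  have := hdel _ hd'.
  have -> : f (ray z r t) - f z0 - l * (ray z r t - z0) = f (ray z r t) - A (ray z r t).
    by rewrite /A; ring.
  by move=> /le_trans; apply; rewrite ler_pM2l.
apply: (le_trans (rect_int_bound z1 cE a_gt0 ab b1 cd hE)).
rewrite -/D /e'.
have -> : 2 / a * (e * a0 / 4 * (2 * D)) * D = e * D ^+ 2 * (a0 / a) by field; rewrite gt_eqF.
rewrite ler_piMr//; first by rewrite mulr_ge0 ?sqr_ge0// ltW.
by rewrite ler_pdivrMr// mul1r.
Qed.

(** * The mean value property and its consequence for |f|^2 *)

(** Over a full turn the two radial sides of the polar rectangle cancel, so
that the mean of Re f over the circle of radius a |z| does not depend on a; it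
tends to Re f(0) as a tends to 0, by continuity. *)
Lemma mean_value (R : realType) (f : Cplx R -> Cplx R) (z : Cplx R) :
  holomorphic_on (unit_disc R) f -> normc z < 1 ->
  Jint (fun t => complex.Re (f (ray z 1 t))) 0 (2 * pi) = 2 * pi * complex.Re (f 0).
Proof.
move=> hf z1; have cf := holo_disc_cont hf.
have pi20 : (0 : R) <= 2 * pi by rewrite mulr_ge0// pi_ge0.
have indep a : 0 < a <= 1 -> Jint (fun t => complex.Re (f (ray z 1 t))) 0 (2 * pi) =
    Jint (fun t => complex.Re (f (ray z a t))) 0 (2 * pi).
  move=> a01; have := goursat_ray hf z1 a01 pi20; rewrite /rect_int.
  have -> : (fun r => complex.Im (f (ray z r (2 * pi))) / r) =
            (fun r => complex.Im (f (ray z r 0)) / r).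
    by apply/funext => r; rewrite /ray /cis mulr_natl cos2pi sin2pi cos0 sin0.
  by rewrite subrr add0r => /eqP; rewrite subr_eq0 => /eqP.
have D0 : unit_disc R 0 by change (normc (0 : R[i]) < 1); rewrite normc0 ltr01.
apply/eqP; rewrite -subr_eq0 -normr_le0; apply/ler_addgt0Pl => e e0; rewrite addr0.
have e1 : 0 < e / (2 * pi) by rewrite divr_gt0// mulr_gt0 ?pi_gt0.
have [d d0 hd] := derivable_continuousC (hf _ D0) e1.
pose a := Num.min 1 (d / 2).
have a0 : 0 < a by rewrite lt_min ltr01 divr_gt0.
have a1 : a <= 1 by rewrite ge_min lexx.
have ad : a < d.
  by rewrite gt_min; apply/orP; right; rewrite ltr_pdivrMr// ltr_pMr// ltr1n.
have -> : Jint (fun t => complex.Re (f (ray z 1 t))) 0 (2 * pi) - 2 * pi * complex.Re (f 0) =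
    Jint (fun t => complex.Re (f (ray z a t)) - complex.Re (f 0)) 0 (2 * pi).
  rewrite JintB; last 2 first.
  - by move=> x _; apply: (disc_cont_t z1 cf); rewrite (ltW a0).
  - by move=> x _; exact: cvg_cst.
  by rewrite Jint_cst// subr0 (indep a) ?a0// [_ * complex.Re _]mulrC.
have -> : e = e / (2 * pi) * (2 * pi - 0).
  by rewrite subr0 divfK// gt_eqF// mulr_gt0 ?pi_gt0.
apply: Jint_bound => // [x _|x _].
  apply: cvgB; last exact: cvg_cst.
  by apply: (disc_cont_t z1 cf); rewrite (ltW a0).
rewrite -raddfB; apply: (le_trans (Re_le_normc _)); apply/ltW/hd.
rewrite subr0 normc_ray ger0_norm ?(ltW a0)// (le_lt_trans _ ad)//.
by rewrite ler_piMr ?(ltW a0)// ltW.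
Qed.

Lemma disc_cont_t_sq (R : realType) (f : Cplx R -> Cplx R) (z : Cplx R) (r : R) :
  disc_cont f -> normc z < 1 -> 0 <= r <= 1 ->
  continuous (fun t => normc (f (ray z r t)) ^+ 2).
Proof.
move=> cf z1 r01 t.
have sqE (w : Cplx R) : normc w ^+ 2 = complex.Re w ^+ 2 + complex.Im w ^+ 2.
  by case: w => x y; rewrite /normc sqr_sqrtr// addr_ge0 ?sqr_ge0.
under eq_fun do rewrite sqE rayE.
apply: (@ray_continuous_t _ z r t
  (fun q => complex.Re (f (cpl q)) ^+ 2 + complex.Im (f (cpl q)) ^+ 2)).
have p1 : normc (cpl (r * (complex.Re z * cos t - complex.Im z * sin t),
  r * (complex.Re z * sin t + complex.Im z * cos t))) < 1.
  by rewrite -rayE ray_in_disc.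
have [c1 c2] := cf _ p1.
by apply: cvgD; [exact: (cvgM c1 c1)|exact: (cvgM c2 c2)].
Qed.

(** The integrable minorant bounds the negative part of g, so that the
integral of g makes sense in ]-oo, +oo]. *)
Lemma le_integral_minorant d (T : measurableType d) (R : realType)
    (mu : {measure set T -> \bar R}) (D : set T) (l g : T -> \bar R) :
  measurable D -> mu.-integrable D l -> measurable_fun D g ->
  (forall x, D x -> (l x <= g x)%E) ->
  (\int[mu]_(x in D) l x <= \int[mu]_(x in D) g x)%E.
Proof.
move=> mD il mg lg; have ml := measurable_int mu il.
rewrite integralE [leRHS]integralE leeB//.
- apply: ge0_le_integral => //.
  + exact: measurable_funepos.
  + exact: measurable_funepos.
  + by move=> x /mem_set; apply: funepos_le => y /set_mem; exact: lg.
- apply: ge0_le_integral => //.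
  + exact: measurable_funeneg.
  + exact: measurable_funeneg.
  + by move=> x /mem_set; apply: funeneg_le => y /set_mem; exact: lg.
Qed.

(** Integrate |f|^2 >= 2 Re f - 1, which is (Re f - 1)^2 + (Im f)^2 >= 0. *)
Lemma sq_mean_value (R : realType) (f : Cplx R -> Cplx R) (z : Cplx R) :
  holomorphic_on (unit_disc R) f -> f 0 = 1 -> normc z < 1 ->
  ((2 * pi)%:E <= \int[@lebesgue_measure R]_(t in `[0%R, (2 * pi)%R])
     (normc (f (ray z 1 t)) ^+ 2)%:E)%E.
Proof.
move=> hf f0 z1; have cf := holo_disc_cont hf.
have pi20 : (0 : R) <= 2 * pi by rewrite mulr_ge0// pi_ge0.
have ci t : {for t, continuous (fun s : R => complex.Re (f (ray z 1 s)))}.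
  by apply: (disc_cont_t z1 cf); rewrite ler01 lexx.
have mv := mean_value hf z1.
pose g t := 2 * complex.Re (f (ray z 1 t)) - 1.
have cg : continuous g.
  by move=> t; apply: cvgB; [apply: cvgMr; exact: ci|exact: cvg_cst].
have ig : (\int[@lebesgue_measure R]_(t in `[0%R, (2 * pi)%R]) (g t)%:E)%E = (2 * pi)%:E.
  rewrite -[LHS]fineK; last by apply: integrable_fin_num => //; exact: continuous_integrable_itv.
  congr EFin; rewrite -[LHS]/(Jint g 0 (2 * pi)) /g JintB; last 2 first.
  - by move=> x _; apply: cvgMr; exact: ci.
  - by move=> x _; exact: cvg_cst.
  rewrite Jint_cst// subr0 mul1r /Jint RintegralZl//; last exact: continuous_integrable_itv.
  rewrite -/(Jint _ _ _) mv f0 /=; ring.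
rewrite -ig; apply: le_integral_minorant => //.
- exact: continuous_integrable_itv.
- apply/measurable_EFinP; apply: measurable_funTS.
  apply: continuous_measurable_fun; apply: disc_cont_t_sq => //.
  by rewrite ler01 lexx.
move=> t _; rewrite lee_fin /g; case: (f _) => x y.
rewrite /normc sqr_sqrtr ?addr_ge0 ?sqr_ge0//=.
by have := sqr_ge0 (x - 1); have := sqr_ge0 y; rewrite sqrrB expr1n mulr1; lra.
Qed.

(** * The least weighted norm *)

(** A copy of planar Lebesgue measure that carries a sigma-finite structure,
which Tonelli's theorem on R x R^2 and R^2 x R^2 requires. *)
Definition plane_measure (R : realType) :
  set (measurableTypeR R * measurableTypeR R)%type -> \bar R := leb2 R.

HB.instance Definition _ (R : realType) := Measure.on (@plane_measure R).

Lemma plane_measure_sigma_finite (R : realType) : sigma_finite setT (@plane_measure R).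
Proof.
exists (fun n => @plane_disc R n%:R).
  apply/esym/seteqP; split => // p _; exists (Num.bound (p.1 ^+ 2 + p.2 ^+ 2)) => //.
  by apply: archi_boundP; rewrite addr_ge0 ?sqr_ge0.
move=> n; split; first exact: measurable_plane_disc.
rewrite /plane_measure plane_disc_area ?ler0n//.
by have /andP[_ h] := plane_disc_area_gt0_lty R; rewrite lte_mul_pinfty// lee_fin ler0n.
Qed.

HB.instance Definition _ (R : realType) :=
  Measure_isSigmaFinite.Build _ _ _ (@plane_measure R)
    (@plane_measure_sigma_finite R).

Lemma continuous_on_open_measurable (R : realType) (D : set (R * R)) (h : R * R -> R) :
  open D -> (forall p, D p -> {for p, continuous h}) -> measurable_fun D h.
Proof.
move=> oD ch; apply: (measurability _ (RGenOpens.measurableE R)).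
move=> _ [_ [a [b ->] <-]]; apply: open_measurable_plane.
rewrite openE => p [Dp hp].
rewrite /interior; apply: filterI; first exact: open_nbhs_nbhs.
by apply: (ch p Dp); apply: open_nbhs_nbhs; split => //; exact: interval_open.
Qed.

Lemma unit_disc_cpl (R : realType) (p : R * R) :
  unit_disc R (cpl p) = plane_disc 1 p.
Proof.
apply/propext; rewrite /unit_disc /plane_disc /cpl /normc /= -[X in _ < X](sqrtr1 R).
by rewrite ltr_sqrt.
Qed.

Lemma normc_sq_cpl (R : realType) (p : R * R) :
  normc (cpl p) ^+ 2 = p.1 ^+ 2 + p.2 ^+ 2.
Proof. by rewrite /normc /cpl /= sqr_sqrtr// addr_ge0 ?sqr_ge0. Qed.

Lemma area_intE (R : realType) (h : Cplx R -> R) :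
  area_int (unit_disc R) h =
  (\int[leb2 R]_(p in plane_disc (1 : R)) (h (cpl p))%:E)%E.
Proof.
rewrite /area_int; congr (integral _ _ _).
by apply/seteqP; split => p /=; rewrite -unit_disc_cpl.
Qed.

Lemma open_plane_disc (R : realType) (rho : R) : open (@plane_disc R rho).
Proof.
have c : continuous (fun p : R * R => p.1 ^+ 2 + p.2 ^+ 2).
  move=> p; apply: cvgD.
    exact: (cvgM cvg_fst cvg_fst).
  exact: (cvgM cvg_snd cvg_snd).
have := open_comp (fun p _ => c p) (@open_lt R rho); rewrite /preimage.
by apply.
Qed.

Lemma rot_disc (R : realType) (c s : R) (p : R * R) : c ^+ 2 + s ^+ 2 = 1 ->
  plane_disc 1 (rot c s p) = plane_disc 1 p.
Proof.
move=> cs; rewrite /plane_disc /rot /=; congr is_true; congr (_ < _).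
rewrite -[RHS]mul1r -cs; ring.
Qed.

Lemma cpl_rot (R : realType) (t : R) (p : R * R) :
  cpl (rot (cos t) (sin t) p) = ray (cpl p) 1 t.
Proof. by rewrite rayE !mul1r /rot /= /cpl /=; congr Complex; ring. Qed.

Lemma measurable_rot_param (R : realType) :
  measurable_fun setT (fun q : R * (R * R) => rot (cos q.1) (sin q.1) q.2).
Proof.
have mc : measurable_fun setT (fun q : R * (R * R) => cos q.1).
  by apply: (measurableT_comp (continuous_measurable_fun (@continuous_cos R))).
have ms : measurable_fun setT (fun q : R * (R * R) => sin q.1).
  by apply: (measurableT_comp (continuous_measurable_fun (@continuous_sin R))).
have m1 : measurable_fun setT (fun q : R * (R * R) => q.2.1).
  by apply: (measurableT_comp measurable_fst measurable_snd).
have m2 : measurable_fun setT (fun q : R * (R * R) => q.2.2).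
  by apply: (measurableT_comp measurable_snd measurable_snd).
apply: measurable_fun_pair => /=.
  by apply: measurable_funB; apply: measurable_funM.
by apply: measurable_funD; apply: measurable_funM.
Qed.

(** Tonelli on [0, 2 pi] x R^2 and the rotation invariance of the area. *)
Lemma integral_rot_average (R : realType) (h : R * R -> \bar R) :
  measurable_fun setT h -> (forall p, (0 <= h p)%E) ->
  ((2 * pi)%:E * \int[leb2 R]_p h p =
   \int[leb2 R]_p \int[@lebesgue_measure R]_(t in `[0%R, (2 * pi)%R])
     h (rot (cos t) (sin t) p))%E /\
  measurable_fun setT (fun p : R * R =>
    \int[@lebesgue_measure R]_(t in `[0%R, (2 * pi)%R]) h (rot (cos t) (sin t) p))%E.
Proof.
move=> mh h0; set I := `[0, 2 * pi]%classic : set R.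
have mI : measurable I by exact: measurable_itv.
have lI : @lebesgue_measure R I = (2 * pi)%:E.
  by rewrite lebesgue_measure_itv/= lte_fin mulr_gt0 ?pi_gt0// -EFinB subr0.
pose G (q : R * (R * R)) : \bar R :=
  ((\1_I q.1 : R)%:E * h (rot (cos q.1) (sin q.1) q.2))%E.
have mG : measurable_fun setT G.
  apply: emeasurable_funM; last exact: measurableT_comp (@measurable_rot_param R).
  apply/measurable_EFinP; apply: (measurableT_comp _ measurable_fst).
  exact: measurable_indic.
have G0 q : (0 <= G q)%E by rewrite mule_ge0// lee_fin.
have E1 : (\int[@lebesgue_measure R]_t \int[leb2 R]_p G (t, p) =
    (2 * pi)%:E * \int[leb2 R]_p h p)%E.
  transitivity (\int[@lebesgue_measure R]_t ((\1_I t : R)%:E * \int[leb2 R]_p h p))%E.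
    apply: eq_integral => t _; rewrite /G /= ge0_integralZl//; last first.
    - exact: (measurableT_comp mh (measurable_rot (cos t) (sin t))).
    - by congr (_ * _)%E; rewrite ge0_integral_rot// cos2Dsin2.
  rewrite ge0_integralZr//; last 2 first.
  - by apply/measurable_EFinP; exact: measurable_indic.
  - exact: integral_ge0.
  congr (_ * _)%E; rewrite integral_indic// setIT; exact: lI.
have E2 p : (\int[@lebesgue_measure R]_t G (t, p) =
    \int[@lebesgue_measure R]_(t in I) h (rot (cos t) (sin t) p))%E.
  rewrite [RHS]integral_mkcond; apply: eq_integral => t _.
  by rewrite /G /= patchE indicE; case: ifPn => _; rewrite ?mul1e ?mul0e.
split; last first.
  rewrite (_ : (fun p => _) = (fun p => \int[@lebesgue_measure R]_t G (t, p)))%E.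
    exact: (@measurable_fun_fubini_tonelli_G _ _ _ _ R (@lebesgue_measure R) G mG G0).
  by apply/funext => p; rewrite E2.
rewrite -E1.
transitivity (\int[leb2 R]_p \int[@lebesgue_measure R]_t G (t, p))%E.
  exact: (@fubini_tonelli _ _ _ _ R (@lebesgue_measure R) (@plane_measure R) G mG G0).
by apply: eq_integral => p _; rewrite E2.
Qed.

(** By [integral_rot_average] the squared norm is the integral over the disc
of the average of |f|^2 exp(-phi) over circles. The weight is constant on each
circle, and the average of |f|^2 there is at least 1. *)
Lemma min_norm_extension (R : realType) (phi : Cplx R -> R) (f : Cplx R -> Cplx R) :
  radial_on (unit_disc R) phi ->
  measurable_fun (plane_disc (1 : R)) (fun p => phi (cpl p)) ->
  holomorphic_on (unit_disc R) f -> f 0 = 1 ->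
  (area_int (unit_disc R) (fun z => expR (- phi z)) <= wnorm2 phi f)%E.
Proof.
move=> rphi mphi hf f0; have cf := holo_disc_cont hf.
set D := plane_disc (1 : R); have mD : measurable D by exact: measurable_plane_disc.
have mw : measurable_fun D (fun p => expR (- phi (cpl p))).
  by apply: (measurableT_comp (@measurable_expR R)); exact: measurable_funN.
pose h := (fun p : R * R => (normc (f (cpl p)) ^+ 2 * expR (- phi (cpl p)))%:E) \_ D.
pose g := (fun p : R * R => (expR (- phi (cpl p)))%:E) \_ D.
have mh : measurable_fun setT h.
  apply/(measurable_restrictT _ mD); apply/measurable_EFinP; apply: measurable_funM => //.
  apply: continuous_on_open_measurable; first exact: open_plane_disc.
  move=> p; rewrite /D -unit_disc_cpl => Dp; have [c1 c2] := cf p Dp.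
  rewrite (_ : (fun q => _) = (fun q => complex.Re (f (cpl q)) ^+ 2 +
     complex.Im (f (cpl q)) ^+ 2)); last first.
    apply/funext => q; case: (f _) => x y.
    by rewrite /normc sqr_sqrtr// addr_ge0 ?sqr_ge0.
  by apply: cvgD; [exact: (cvgM c1 c1)|exact: (cvgM c2 c2)].
have h0 p : (0 <= h p)%E.
  by rewrite /h patchE; case: ifPn => // _; rewrite lee_fin mulr_ge0 ?sqr_ge0 ?expR_ge0.
have mg : measurable_fun setT g.
  by apply/(measurable_restrictT _ mD); exact/measurable_EFinP.
have g0 p : (0 <= g p)%E.
  by rewrite /g patchE; case: ifPn => // _; rewrite lee_fin expR_ge0.
rewrite /wnorm2 !area_intE.
have -> : (\int[leb2 R]_(p in D) (expR (- phi (cpl p)))%:E = \int[leb2 R]_p g p)%E.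
  exact: integral_mkcond.
have -> : (\int[leb2 R]_(p in D) (normc (f (cpl p)) ^+ 2 * expR (- phi (cpl p)))%:E =
    \int[leb2 R]_p h p)%E.
  exact: integral_mkcond.
have pi20 : (0 < (2 * pi)%:E :> \bar R)%E by rewrite lte_fin mulr_gt0 ?pi_gt0.
suff : ((2 * pi)%:E * \int[leb2 R]_p g p <= (2 * pi)%:E * \int[leb2 R]_p h p)%E.
  by rewrite lee_pmul2l.
have [-> mI] := integral_rot_average mh h0.
rewrite -ge0_integralZl//; last exact: ltW.
apply: ge0_le_integral => //.
- by move=> p _; rewrite mule_ge0// ltW.
- exact: emeasurable_funM.
move=> p _; rewrite /g patchE; case: ifPn => [pD|pD]; last first.
  by rewrite mule0; apply: integral_ge0 => t _; exact: h0.
have Dp : normc (cpl p) < 1 by rewrite -[is_true _]/(unit_disc R (cpl p)) unit_disc_cpl; exact: set_mem.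
rewrite [leRHS](_ : _ = (\int[@lebesgue_measure R]_(t in `[0%R, (2 * pi)%R])
  ((expR (- phi (cpl p)))%:E * (normc (f (ray (cpl p) 1 t)) ^+ 2)%:E))%E); last first.
  apply: eq_integral => t _; rewrite /h patchE mem_set; last first.
    by rewrite /D rot_disc ?cos2Dsin2// -unit_disc_cpl.
  rewrite cpl_rot -EFinM mulrC; congr (expR (- _) * _)%:E.
  have nr : normc (ray (cpl p) 1 t) = normc (cpl p) by rewrite normc_ray normr1 mul1r.
  have Dr : unit_disc R (ray (cpl p) 1 t).
    by change (normc (ray (cpl p) 1 t) < 1); rewrite nr.
  exact: rphi.
rewrite ge0_integralZl ?lee_fin ?expR_ge0//; last first.
- by move=> t _; rewrite lee_fin sqr_ge0.
- apply/measurable_EFinP; apply: measurable_funTS; apply: continuous_measurable_fun.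
  by apply: disc_cont_t_sq => //; rewrite ler01 lexx.
rewrite muleC; apply: lee_wpmul2l; first by rewrite lee_fin expR_ge0.
exact: sq_mean_value.
Qed.

(** * Volumes of dual sets *)

(** Both integrals, multiplied by the area c of the unit disc, are the volume
in R^2 x R^2 of the set where |q|^2 < F p: for fixed p it is a disc of area c
F(p), and for fixed q a disc of area c G(q). *)
Lemma integral_exchange (R : realType) (F G : R * R -> R) :
  measurable_fun setT F -> measurable_fun setT G ->
  (forall p, 0 <= F p) -> (forall q, 0 <= G q) ->
  (forall p q, (q.1 ^+ 2 + q.2 ^+ 2 < F p) = (p.1 ^+ 2 + p.2 ^+ 2 < G q)) ->
  (\int[leb2 R]_p (F p)%:E = \int[leb2 R]_q (G q)%:E)%E.
Proof.
move=> mF mG F0 G0 FG.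
pose k (w : (R * R) * (R * R)) : \bar R :=
  (if w.2.1 ^+ 2 + w.2.2 ^+ 2 < F w.1 then 1 else 0)%:E.
have mk : measurable_fun setT k.
  apply/measurable_EFinP; apply: measurable_fun_ifT => //.
  apply: measurable_fun_ltr; last exact: (measurableT_comp mF measurable_fst).
  apply: measurable_funD; apply: measurable_funX.
    exact: (measurableT_comp measurable_fst measurable_snd).
  exact: (measurableT_comp measurable_snd measurable_snd).
have k0 w : (0 <= k w)%E by rewrite /k lee_fin; case: ifP.
pose c := leb2 R (plane_disc (1 : R)).
have /andP[c0 coo] : (0 < c < +oo)%E := plane_disc_area_gt0_lty R.
have cfin : c \is a fin_num by rewrite ge0_fin_numE// ltW.
have inner (r : R) : 0 <= r ->
    (\int[leb2 R]_q (if q.1 ^+ 2 + q.2 ^+ 2 < r then 1 else 0)%:E = c * r%:E)%E.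
  move=> r0; rewrite muleC -plane_disc_area//.
  transitivity (\int[leb2 R]_q (\1_(plane_disc r) q : R)%:E)%E.
    apply: eq_integral => q _; rewrite indicE; congr EFin.
    case: ifPn => h; first by rewrite mem_set.
    by rewrite memNset//; exact/negP.
  by rewrite integral_indic ?setIT//; exact: measurable_plane_disc.
have scale (H : R * R -> R) : measurable_fun setT H -> (forall p, 0 <= H p) ->
    (\int[leb2 R]_p (c * (H p)%:E) = c * \int[leb2 R]_p (H p)%:E)%E.
  move=> mH H0; rewrite ge0_integralZl//; last exact: ltW.
  - exact/measurable_EFinP.
  - by move=> p _; rewrite lee_fin.
have E1 : (\int[leb2 R]_p \int[leb2 R]_q k (p, q) = c * \int[leb2 R]_p (F p)%:E)%E.
  by rewrite -scale//; apply: eq_integral => p _; rewrite -inner.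
have E2 : (\int[leb2 R]_q \int[leb2 R]_p k (p, q) = c * \int[leb2 R]_q (G q)%:E)%E.
  rewrite -scale//; apply: eq_integral => q _; rewrite -inner//.
  by apply: eq_integral => p _; rewrite /k /= FG.
have : (c * \int[leb2 R]_p (F p)%:E = c * \int[leb2 R]_q (G q)%:E)%E.
  rewrite -E1 -E2.
  exact: (@fubini_tonelli _ _ _ _ R (@plane_measure R) (@plane_measure R) k mk k0).
by move=> h; apply/eqP; rewrite eq_le; apply/andP; split;
  rewrite -(lee_pmul2l cfin c0) h lexx.
Qed.

(** Extension of F and G by 0 outside the disc. The bound by 1 ensures that
|q|^2 < F p forces q to be in the disc, and conversely. *)
Lemma area_exchange (R : realType) (F G : R * R -> R) :
  measurable_fun (plane_disc (1 : R)) F -> measurable_fun (plane_disc (1 : R)) G ->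
  (forall p, plane_disc 1 p -> 0 <= F p <= 1) ->
  (forall p, plane_disc 1 p -> 0 <= G p <= 1) ->
  (forall p q, plane_disc 1 p -> plane_disc 1 q ->
     (q.1 ^+ 2 + q.2 ^+ 2 < F p) = (p.1 ^+ 2 + p.2 ^+ 2 < G q)) ->
  (\int[leb2 R]_(p in plane_disc (1 : R)) (F p)%:E =
   \int[leb2 R]_(q in plane_disc (1 : R)) (G q)%:E)%E.
Proof.
move=> mF mG F01 G01 FG; set D := plane_disc (1 : R).
have mD : measurable D by exact: measurable_plane_disc.
have ext (H : R * R -> R) :
    (\int[leb2 R]_(p in D) (H p)%:E = \int[leb2 R]_p ((H \_ D) p)%:E)%E.
  transitivity (\int[leb2 R]_p ((fun p => (H p)%:E) \_ D) p)%E.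
    exact: integral_mkcond.
  by apply: eq_integral => p _; rewrite /patch; case: ifP.
have nn (p : R * R) : 0 <= p.1 ^+ 2 + p.2 ^+ 2 by rewrite addr_ge0 ?sqr_ge0.
rewrite !ext; apply: integral_exchange.
- by apply/(measurable_restrictT _ mD).
- by apply/(measurable_restrictT _ mD).
- by move=> p; rewrite patchE; case: ifPn => // /set_mem /F01 /andP[].
- by move=> p; rewrite patchE; case: ifPn => // /set_mem /G01 /andP[].
move=> p q; rewrite !patchE.
have [/set_mem pD|pD] := boolP (p \in D); have [/set_mem qD|qD] := boolP (q \in D).
- exact: FG.
- rewrite [RHS]ltNge nn; apply/negbTE; rewrite -leNgt.
  apply: (@le_trans _ _ 1); first by case/andP: (F01 _ pD).
  by rewrite leNgt; apply/negP => h; move/negP: qD; apply; rewrite inE.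
- rewrite [LHS]ltNge nn; apply/esym/negbTE; rewrite -leNgt.
  apply: (@le_trans _ _ 1); first by case/andP: (G01 _ qD).
  by rewrite leNgt; apply/negP => h; move/negP: pD; apply; rewrite inE.
- by rewrite !ltNge !nn.
Qed.

(** * Convex functions on the negative half-line *)

Lemma convex_function_mix (R : realType) (u : R -> R) :
  @convex_function R R^o `]-oo, 0[%classic u ->
  forall x y l : R, x < 0 -> y < 0 -> 0 <= l <= 1 ->
  u (l * x + (1 - l) * y) <= l * u x + (1 - l) * u y.
Proof.
move=> cu x y l x0 y0 /andP[l0 l1].
pose t : {i01 R} := Itv01 l0 l1.
have := cu t x y; rewrite !inE /= !in_itv /= => /(_ x0 y0).
by rewrite !convRE.
Qed.

Lemma mix_convex_function (R : realType) (u : R -> R) :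
  (forall x y l : R, x < 0 -> y < 0 -> 0 <= l <= 1 ->
  u (l * x + (1 - l) * y) <= l * u x + (1 - l) * u y) ->
  @convex_function R R^o `]-oo, 0[%classic u.
Proof.
move=> cu t x y; rewrite !inE /= !in_itv /= => x0 y0; rewrite !convRE.
by apply: cu => //; apply/andP; split; [exact: ge0|exact: le1].
Qed.

(** What is used of convexity and monotonicity of u on ]-oo, 0[: supporting
lines, with nonnegative slopes. *)
Definition profile (R : realType) (u : R -> R) :=
  (forall s t, s <= t -> t < 0 -> u s <= u t) /\
  (forall t0, t0 < 0 -> exists2 k : R, 0 <= k &
     forall t, t < 0 -> u t0 + k * (t - t0) <= u t).

Lemma convex_slope (R : realType) (u : R -> R) (s t r : R) :
  @convex_function R R^o `]-oo, 0[%classic u -> s < t -> t < r -> r < 0 ->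
  (u t - u s) / (t - s) <= (u r - u t) / (r - t).
Proof.
move=> cu st tr r0; have t0 := lt_trans tr r0; have s0 := lt_trans st t0.
have sr := lt_trans st tr.
have d1 : 0 < t - s by rewrite subr_gt0.
have d2 : 0 < r - t by rewrite subr_gt0.
have d3 : 0 < r - s by rewrite subr_gt0.
pose l := (r - t) / (r - s).
have l01 : 0 <= l <= 1.
  by rewrite divr_ge0 ?(ltW d2) ?(ltW d3)//= ler_pdivrMr// mul1r lerD2l lerN2 ltW.
have := convex_function_mix cu s0 r0 l01.
have -> : l * s + (1 - l) * r = t by rewrite /l; field; rewrite gt_eqF.
have -> : l * u s + (1 - l) * u r = ((r - t) * u s + (t - s) * u r) / (r - s).
  by rewrite /l; field; rewrite gt_eqF.
rewrite ler_pdivlMr// => h.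
rewrite ler_pdivrMr// mulrAC ler_pdivlMr//; nra.
Qed.

(** The slope of the supporting line is the supremum of the slopes of the
chords on the left. *)
Lemma convex_profile (R : realType) (u : R -> R) :
  @convex_function R R^o `]-oo, 0[%classic u ->
  {in `]-oo, 0[ &, {homo u : s t / s <= t}} -> profile u.
Proof.
move=> cu hu.
have mu s t : s <= t -> t < 0 -> u s <= u t.
  by move=> st t0; apply: hu; rewrite ?in_itv//= (le_lt_trans st).
split=> // t0 t00.
pose S := [set (u t0 - u s) / (t0 - s) | s in [set s | s < t0]].
have S0 : S !=set0 by exists ((u t0 - u (t0 - 1)) / (t0 - (t0 - 1))), (t0 - 1) => //=; lra.
have ubS r : t0 < r -> r < 0 -> ubound S ((u r - u t0) / (r - t0)).
  by move=> tr r0 _ [s /= st <-]; exact: convex_slope.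
have hS : has_ubound S.
  by exists ((u (t0 / 2) - u t0) / (t0 / 2 - t0)); apply: ubS; lra.
exists (sup S).
  apply: (@le_trans _ _ ((u t0 - u (t0 - 1)) / (t0 - (t0 - 1)))).
    by rewrite divr_ge0// ?subr_ge0; [apply: mu; lra|lra].
  by apply: ub_le_sup => //; exists (t0 - 1) => //=; lra.
move=> t tl0; have [tt0|tt0|->] := ltgtP t t0; last by rewrite subrr mulr0 addr0.
- have : (u t0 - u t) / (t0 - t) <= sup S by apply: ub_le_sup => //; exists t.
  rewrite ler_pdivrMr ?subr_gt0//; lra.
- have : sup S <= (u t - u t0) / (t - t0) by apply: ge_sup => //; exact: ubS.
  rewrite ler_pdivlMr ?subr_gt0//; lra.
Qed.

(** Near t0 the function is Lipschitz: below t0 by the supporting line at t0,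
above t0 because the slope of the supporting line at t is at most that of the
chord from t to t0 / 2, which is bounded for t < 3 t0 / 4. *)
Lemma profile_continuous (R : realType) (u : R -> R) (t0 : R) :
  profile u -> t0 < 0 -> {for t0, continuous u}.
Proof.
move=> [mu su] t00; have [k k0 hk] := su t0 t00.
pose m := (u (t0 / 2) - u t0) / (- t0 / 4).
have m0 : 0 <= m by rewrite divr_ge0// ?subr_ge0; [apply: mu; lra|lra].
pose K := k + m + 1; have K0 : 0 < K by rewrite /K; lra.
(* m bounds the slope of the chord from t to t0 / 2 for t0 < t < 3 t0 / 4. *)
have lip t : t < 3 / 4 * t0 -> `|u t - u t0| <= K * `|t - t0|.
  move=> tb; have tl0 : t < 0 by lra.
  have [le|lt] := leP t t0.
    rewrite [X in X <= _]distrC [X in _ * X]distrC !ger0_norm ?subr_ge0 ?mu//.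
    have := hk t tl0; have : 0 <= (m + 1) * (t0 - t) by rewrite mulr_ge0; lra.
    by rewrite /K; lra.
  have ut := mu _ _ (ltW lt) tl0.
  rewrite (ger0_norm (_ : 0 <= u t - u t0)) ?subr_ge0//.
  rewrite (gtr0_norm (_ : 0 < t - t0)) ?subr_gt0//.
  have [k' k'0 hk'] := su t tl0.
  have h1 := hk' t0 t00; have h2 := hk' (t0 / 2) ltac:(lra).
  have km : k' <= m.
    rewrite /m ler_pdivlMr; last by lra.
    have : 0 <= k' * (t0 / 2 - t - (- t0 / 4)) by rewrite mulr_ge0; lra.
    lra.
  have : 0 <= (m - k') * (t - t0) by rewrite mulr_ge0; lra.
  have : 0 <= (k + 1) * (t - t0) by rewrite mulr_ge0; lra.
  by rewrite /K; lra.
apply/cvgrPdist_lt => e e0.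
have d1 : 0 < - t0 / 4 by lra.
have d0 : 0 < Num.min (- t0 / 4) (e / K) by rewrite lt_min d1 divr_gt0.
apply: filterS (nbhsx_ballx t0 _ d0) => t; rewrite /ball /= lt_min => /andP[h1 h2].
rewrite distrC; apply: (le_lt_trans (lip t _)).
  by move: h1; rewrite ltr_norml => /andP[? ?]; lra.
by rewrite mulrC -ltr_pdivlMr// distrC.
Qed.

(** The profile of - log (1 - |z|^2) as a function of log |z|^2. *)
Definition exp_convex (R : realType) (t : R) := - ln (1 - expR t).

(** The slope is the derivative at t0. The bound follows from ln y <= y - 1 at
y = (1 - e^t) / (1 - e^t0) and from e^t - e^t0 >= e^t0 (t - t0). *)
Lemma exp_convex_support (R : realType) (t0 t : R) : t0 < 0 -> t < 0 ->
  exp_convex t0 + expR t0 / (1 - expR t0) * (t - t0) <= exp_convex t.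
Proof.
move=> t00 tl0; rewrite /exp_convex.
have x1 : expR t < 1 by rewrite expR_lt1.
have x01 : expR t0 < 1 by rewrite expR_lt1.
have x00 := expR_gt0 t0.
have hx : expR t0 * (t - t0) <= expR t - expR t0.
  have -> : expR t = expR t0 * expR (t - t0) by rewrite -expRD addrC subrK.
  by have := ler_wpM2l (ltW x00) (expR_ge1Dx (t - t0)); lra.
set x := expR t in x1 hx *; set x0 := expR t0 in x01 x00 hx *.
have y : 0 < 1 - x by lra.
have y0 : 0 < 1 - x0 by lra.
have h1 : ln ((1 - x) / (1 - x0)) <= (1 - x) / (1 - x0) - 1.
  rewrite -{1}[(1 - x) / (1 - x0)](subrK 1) addrC le_ln1Dx//.
  by rewrite ltrBrDr addrC subrr divr_gt0.
rewrite ln_div ?posrE// in h1.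
have h2 : x0 / (1 - x0) * (t - t0) <= 1 - (1 - x) / (1 - x0).
  have -> : 1 - (1 - x) / (1 - x0) = (x - x0) / (1 - x0) by field; rewrite gt_eqF.
  by rewrite mulrAC ler_wpM2r// invr_ge0 ltW.
lra.
Qed.

Lemma exp_convex_slope_gt0 (R : realType) (t0 : R) : t0 < 0 ->
  0 < expR t0 / (1 - expR t0).
Proof. by move=> t00; rewrite divr_gt0 ?expR_gt0// subr_gt0 expR_lt1. Qed.

Lemma exp_convex_lt (R : realType) (s t : R) : s < t -> t < 0 ->
  exp_convex s < exp_convex t.
Proof.
move=> st t0; have s0 := lt_trans st t0.
apply: (lt_le_trans _ (exp_convex_support s0 t0)).
by rewrite ltrDl mulr_gt0 ?exp_convex_slope_gt0// subr_gt0.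
Qed.

Lemma exp_convex_pinfty (R : realType) : exp_convex t @[t --> (0:R)^'-] --> +oo.
Proof.
apply/cvgryPge => A; have hA : 1 - expR (- A) < 1 by rewrite gtrBl expR_gt0.
near=> t; rewrite /exp_convex lerNr -[leRHS]expRK.
have t0 : t < 0 by near: t; exact: nbhs_left_lt.
have h : 0 < 1 - expR t by rewrite subr_gt0 expR_lt1.
rewrite ler_ln ?posrE ?expR_gt0// lerBlDr -lerBlDl.
near: t; have c : expR t @[t --> (0:R)^'-] --> (1:R).
  by rewrite -[X in _ --> X](@expR0 R); apply: cvg_at_left_filter; exact: continuous_expR.
by have /cvgr_gt/(_ _ hA) := c; apply: filterS => s /ltW.
Unshelve. all: by end_near. Qed.

(** A function with supporting lines is convex: compare the end points with
the supporting line at the intermediate point. *)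
Lemma support_mix (R : realType) (u : R -> R) :
  (forall t0, t0 < 0 -> exists2 k : R, 0 <= k &
     forall t, t < 0 -> u t0 + k * (t - t0) <= u t) ->
  forall x y l : R, x < 0 -> y < 0 -> 0 <= l <= 1 ->
  u (l * x + (1 - l) * y) <= l * u x + (1 - l) * u y.
Proof.
move=> su x y l x0 y0 /andP[l0 l1].
have m0 : l * x + (1 - l) * y < 0.
  have [->|lN0] := eqVneq l 0; first by rewrite mul0r add0r subr0 mul1r.
  have : l * x < 0 by rewrite pmulr_rlt0// lt_neqAle eq_sym lN0.
  have : (1 - l) * y <= 0 by rewrite mulr_ge0_le0 ?subr_ge0// ltW.
  lra.
have [k _ hk] := su _ m0; set m := l * x + (1 - l) * y in hk m0 *.
have h1 := ler_wpM2l l0 (hk x x0).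
have h2 : (1 - l) * (u m + k * (y - m)) <= (1 - l) * u y.
  by rewrite ler_wpM2l ?subr_ge0//; exact: hk.
have e : l * (u m + k * (x - m)) + (1 - l) * (u m + k * (y - m)) =
   u m + k * (l * x + (1 - l) * y - m) by ring.
rewrite -/m subrr mulr0 addr0 in e; lra.
Qed.

(** * Radial weights *)

Lemma normc_radius (R : realType) (r t : R) : 0 <= r ->
  normc ((r%:C)%C * (cos t +i* sin t)%C : Cplx R) = r.
Proof. by move=> r0; rewrite normcM normc_real (@normc_cis R) mulr1 ger0_norm. Qed.

(** The sub-mean value inequality at 0 on the circle where log |z|^2 = t reads
0 <= u t. *)
Lemma radial_weight_ge0 (R : realType) (phi : Cplx R -> R) (u : R -> R) (t : R) :
  radial_weight phi u -> t < 0 -> 0 <= u t.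
Proof.
move=> [[_ _ sub] rad phi0 _ phiu] t0.
(* The radius for which log r^2 = t. *)
pose r := expR (t / 2); have r0 : 0 < r by exact: expR_gt0.
have r2 : r ^+ 2 = expR t by rewrite -expRM_natl -mulr_natl; congr expR; field.
have r1 : r < 1 by rewrite expR_lt1; lra.
have := sub 0 r r0; rewrite /circle_int /=.
have -> : (\int[@lebesgue_measure R]_(s in [set` `[0%R, (2 * pi)%R]])
    (phi (0 + r%:C%C * (cos s +i* sin s)%C))%:E)%E = (u t * (2 * pi))%:E.
  transitivity (\int[@lebesgue_measure R]_(s in `[0%R, (2 * pi)%R]) (cst (u t)%:E) s)%E.
    apply: eq_integral => s _; rewrite add0r phiu normc_radius ?ltW//.
    - by rewrite r2 expRK.
    - by rewrite r0.
  transitivity ((u t)%:E * @lebesgue_measure R `[0%R, (2 * pi)%R])%E.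
    exact: integral_cst.
  by rewrite lebesgue_measure_itv/= lte_fin mulr_gt0 ?pi_gt0// -EFinB subr0.
move=> h; have : ((phi 0)%:E <= ((2 * pi)^-1 * (u t * (2 * pi)))%:E)%E.
  by apply: h => z; rewrite subr0 => zr; exact: le_lt_trans r1.
by rewrite phi0 lee_fin mulrCA mulVf ?mulr1// gt_eqF// mulr_gt0 ?pi_gt0.
Qed.

Lemma radial_weight_ge0_disc (R : realType) (phi : Cplx R -> R) (u : R -> R) z :
  radial_weight phi u -> normc z < 1 -> 0 <= phi z.
Proof.
move=> hw z1; have [_ _ phi0 _ phiu] := hw.
have [->|z0] := eqVneq z 0; first by rewrite phi0.
have nz : 0 < normc z.
  rewrite lt_neqAle normc_ge0 andbT eq_sym; apply: contra z0 => /eqP h.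
  by apply/eqP; exact: eq0_normc.
rewrite phiu ?nz//; apply: (radial_weight_ge0 hw).
by rewrite ln_lt0// exprn_gt0//= exprn_ilt1// ltW.
Qed.

(** Upper semicontinuity at 0; together with nonnegativity it gives continuity
at 0. *)
Lemma radial_weight_small (R : realType) (phi : Cplx R -> R) (u : R -> R) (e : R) :
  radial_weight phi u -> 0 < e ->
  exists2 d : R, 0 < d & forall z, normc z < d -> phi z < e.
Proof.
move=> [[_ usc _] rad phi0 _ phiu] e0.
have D0 : unit_disc R 0 by change (normc (0 : R[i]) < 1); rewrite normc0 ltr01.
have [_ /(_ e)] := usc 0 D0; rewrite /= phi0 lte_fin => /(_ e0).
move=> /nearC[d d0 hd]; exists d => // z zd.
by have := hd z; rewrite subr0 lte_fin; apply.
Qed.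

Lemma radial_weight_profile (R : realType) (phi : Cplx R -> R) (u : R -> R) :
  radial_weight phi u -> profile u.
Proof. by case=> _ _ _ [cu mu] _; exact: convex_profile. Qed.

(** * Continuity in the complex variable *)

(** The real-valued logarithm of |z|^2, with junk value 0 at z = 0. *)
Definition logsq (R : realType) (z : Cplx R) : R := ln (normc z ^+ 2).

Lemma normc_gt0 (R : realType) (z : Cplx R) : (0 < normc z) = (z != 0).
Proof.
rewrite lt_neqAle normc_ge0 andbT eq_sym; apply/idP/idP; apply: contra => /eqP h.
  by rewrite h; apply/eqP; exact: normc0.
by apply/eqP; exact: eq0_normc.
Qed.

Lemma logsq_lt0 (R : realType) (z : Cplx R) : 0 < normc z < 1 -> logsq z < 0.
Proof.
move=> /andP[z0 z1]; rewrite /logsq ln_lt0// exprn_gt0//=.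
by rewrite exprn_ilt1// ltW.
Qed.

(** Continuity at z of a real-valued function with real radii; see [contCP].
*)
Definition contC (R : realType) (g : Cplx R -> R) (z : Cplx R) :=
  forall e : R, 0 < e -> exists2 d : R, 0 < d &
    forall y, normc (y - z) < d -> `|g y - g z| < e.

Lemma contCP (R : realType) (g : Cplx R -> R) (z : Cplx R) :
  contC g z <-> {for z, continuous g}.
Proof.
split=> [h|h].
  apply/(@cvgrPdist_lt _ _ _ (nbhs z) _) => e e0; apply/nearC; have [d d0 hd] := h e e0.
  by exists d => // y /hd; rewrite distrC.
move=> e e0; have /(@cvgrPdist_lt _ _ _ (nbhs z) _)/(_ e e0)/nearC[d d0 hd] := h.
by exists d => // y /hd; rewrite distrC.
Qed.

Lemma contC_comp (R : realType) (g : Cplx R -> R) (v : R -> R) (z : Cplx R) :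
  contC g z -> {for g z, continuous v} -> contC (fun y => v (g y)) z.
Proof.
by move=> /contCP cg cv; apply/contCP; apply: continuous_comp cg cv.
Qed.

Lemma contC_normc (R : realType) (z : Cplx R) : contC (@normc R) z.
Proof.
move=> e e0; exists e => // y; apply: le_lt_trans.
rewrite ler_norml; apply/andP; split.
  by rewrite lerNl opprB lerBlDr normcB -{1}[z](subrK y) le_normcD.
by rewrite lerBlDr -{1}[y](subrK z) le_normcD.
Qed.

Lemma contC_logsq (R : realType) (z : Cplx R) : z != 0 -> contC (@logsq R) z.
Proof.
move=> z0; apply: (contC_comp (v := fun x => ln (x ^+ 2)) (@contC_normc R z)).
have c : {for normc z, continuous (fun x : R => x ^+ 2)} by exact: exprn_continuous.
apply: (continuous_comp c); apply: continuous_ln.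
by rewrite exprn_gt0// normc_gt0.
Qed.

Lemma contC_near (R : realType) (g h : Cplx R -> R) (z : Cplx R) (d : R) : 0 < d ->
  (forall y, normc (y - z) < d -> g y = h y) -> contC g z -> contC h z.
Proof.
move=> d0 gh cg e e0; have [d' d'0 hd'] := cg e e0.
exists (Num.min d d'); first by rewrite lt_min d0.
move=> y; rewrite lt_min => /andP[y1 y2]; rewrite -gh// -gh; first exact: hd'.
by rewrite subrr normc0.
Qed.

Lemma disc_punctured_nbhs (R : realType) (z : Cplx R) : 0 < normc z < 1 ->
  exists2 d : R, 0 < d & forall y, normc (y - z) < d -> 0 < normc y < 1.
Proof.
move=> /andP[z0 z1]; have m0 : 0 < Num.min (normc z) (1 - normc z).
  by rewrite lt_min z0 subr_gt0.
have [d d0 hd] := @contC_normc R z _ m0; exists d => // y /hd.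
rewrite lt_min => /andP[]; rewrite !ltr_norml => /andP[h1 h2] /andP[h3 h4].
by apply/andP; split; lra.
Qed.

(** * Continuity of the weight *)

Section weight.
Context {R : realType} (phi : Cplx R -> R) (u : R -> R).
Context (hw : radial_weight phi u).

Lemma weightE (z : Cplx R) : 0 < normc z < 1 -> phi z = u (logsq z).
Proof. by case: hw => _ _ _ _ h z01; rewrite h. Qed.

(** Away from 0 the weight is a continuous function of log |z|^2; at 0 it is
nonnegative and upper semicontinuous with value 0. *)
Lemma weight_continuous (z : Cplx R) : normc z < 1 -> contC phi z.
Proof.
move=> z1; have [z0|z0] := eqVneq z 0.
  rewrite z0 => e e0; have [d d0 hd] := radial_weight_small hw e0.
  have [_ _ p0 _ _] := hw.
  exists (Num.min 1 d); first by rewrite lt_min ltr01.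
  move=> y; rewrite subr0 lt_min => /andP[y1 yd].
  by rewrite p0 subr0 ger0_norm ?hd// (radial_weight_ge0_disc hw).
have z01 : 0 < normc z < 1 by rewrite normc_gt0 z0.
have [d d0 hd] := disc_punctured_nbhs z01.
apply: (@contC_near _ (fun y => u (logsq y)) _ _ d d0).
  by move=> y /hd y01; rewrite weightE.
apply: (contC_comp (contC_logsq z0)); apply: profile_continuous.
  exact: radial_weight_profile hw.
exact: logsq_lt0.
Qed.

Lemma contC_measurable (g : Cplx R -> R) :
  (forall z, normc z < 1 -> contC g z) ->
  measurable_fun (plane_disc (1 : R)) (fun p => g (cpl p)).
Proof.
move=> cg; apply: continuous_on_open_measurable; first exact: open_plane_disc.
move=> p; rewrite -unit_disc_cpl => p1.
exact: (continuous_cpl_comp (cg _ p1)).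
Qed.

Lemma weight_measurable : measurable_fun (plane_disc (1 : R)) (fun p => phi (cpl p)).
Proof. by apply: contC_measurable => z; exact: weight_continuous. Qed.

End weight.

(** * The function psi *)

(** Supported from below at each nonzero point by an increasing affine
function of log |z|^2, and at 0 by the constant 0. This property implies the
sub-mean value inequality on circles, and psi and the regularized weights
share it. *)
Definition log_supported (R : realType) (g : Cplx R -> R) :=
  [/\ g 0 = 0, (forall z, normc z < 1 -> 0 <= g z) &
    forall z0, 0 < normc z0 < 1 -> exists2 k : R, 0 < k &
      forall z, 0 < normc z < 1 -> g z0 + k * (logsq z - logsq z0) <= g z].

Section exhaustive.
Context {R : realType} (phi : Cplx R -> R) (u : R -> R).
Context (he : exhaustive_weight phi u).

Let hw : radial_weight phi u. Proof. by case: he. Qed.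

Lemma exhaustive_mono (s t : R) : s < t -> t < 0 -> u s < u t.
Proof.
by case: he => _ h _ st t0; apply: h; rewrite ?in_itv//= (lt_trans st).
Qed.

Lemma exhaustive_mono_iff (s t : R) : s < 0 -> t < 0 -> (u s < u t) = (s < t).
Proof.
move=> s0 t0; apply/idP/idP => [|st]; last exact: exhaustive_mono.
by apply: contraLR; rewrite -!leNgt le_eqVlt => /predU1P[->//|ts]; rewrite ltW// exhaustive_mono.
Qed.

Lemma exhaustive_gt0 (t : R) : t < 0 -> 0 < u t.
Proof.
move=> t0; have t1 : t - 1 < t by lra.
by apply: le_lt_trans (exhaustive_mono t1 t0); apply: (radial_weight_ge0 hw); lra.
Qed.

(** The slope is positive since u is strictly increasing. *)
Lemma exhaustive_support (t0 : R) : t0 < 0 -> exists2 k : R, 0 < k &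
  forall t, t < 0 -> u t0 + k * (t - t0) <= u t.
Proof.
move=> t00; have [_ /(_ t0 t00)[k k0 hk]] := radial_weight_profile hw.
exists k => //; rewrite lt_neqAle k0 andbT eq_sym; apply/eqP => kz.
have := hk (t0 - 1) ltac:(lra); rewrite kz mul0r addr0.
by apply/negP; rewrite -ltNge; apply: exhaustive_mono => //; lra.
Qed.

(** Intermediate value theorem; u takes arbitrarily small values as phi is
continuous at 0, and arbitrarily large ones as u tends to +oo at 0. *)
Lemma exhaustive_surj (y : R) : 0 < y -> exists2 t : R, t < 0 & u t = y.
Proof.
move=> y0.
have [a a0 ay] : exists2 a : R, a < 0 & u a < y.
  have [d d0 hd] := radial_weight_small hw y0.
  pose r := Num.min (d / 2) 2^-1.
  have r0 : 0 < r by rewrite lt_min; apply/andP; split; rewrite ?invr_gt0// divr_gt0.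
  have r1 : r < 1 by rewrite gt_min invf_lt1// ltr1n orbT.
  have rd : r < d by rewrite gt_min ltr_pdivrMr// ltr_pMr// ltr1n.
  have nr : normc (r%:C%C : Cplx R) = r by rewrite normc_real gtr0_norm.
  have r01 : 0 < normc (r%:C%C : Cplx R) < 1 by rewrite nr r0.
  exists (logsq (r%:C%C : Cplx R)); first exact: logsq_lt0.
  by rewrite -(weightE hw r01); apply: hd; rewrite nr.
have [b b0 yb] : exists2 b : R, b < 0 & y < u b.
  have [_ _ /cvgryPgt/(_ y) hy] := he.
  have : \forall b \near (0 : R)^'-, b < 0 /\ y < u b.
    by near=> b; split; near: b; [exact: nbhs_left_lt|exact: hy].
  by move=> /filter_ex[b []]; exists b.
have ab : a < b by rewrite -exhaustive_mono_iff// (lt_trans ay).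
have cu : {within `[a, b], continuous u}.
  apply: continuous_in_subspaceT => x; rewrite inE /= in_itv /= => /andP[_ xb].
  by apply: profile_continuous; [exact: radial_weight_profile hw|exact: le_lt_trans b0].
have yab : Num.min (u a) (u b) <= y <= Num.max (u a) (u b).
  by rewrite ge_min le_max (ltW ay) (ltW yb) orbT.
have [c cab uc] := IVT (ltW ab) cu yab.
exists c => //; move: cab; rewrite in_itv /= => /andP[_ cb]; exact: le_lt_trans b0.
Unshelve. all: by end_near. Qed.

(** The defining property of psi: the number - psi(w) is the solution t < 0 of
u t = - log |w|^2. *)
Lemma psiP (w : Cplx R) : 0 < normc w < 1 ->
  0 < psi u w /\ u (- psi u w) = - logsq w.
Proof.
move=> w01; have y0 : 0 < - logsq w by rewrite oppr_gt0 logsq_lt0.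
have /andP[nw _] := w01; rewrite /psi ifF; last by apply/negbTE; rewrite -normc_gt0.
have [t t0 ut] := exhaustive_surj y0.
have inj : {in `]-oo, (0:R)[%classic &, injective u}.
  move=> x x'; rewrite !inE /= !in_itv /= => x0 x'0 uxx'.
  have [lt|lt|//] := ltgtP x x'.
    by have := exhaustive_mono lt x'0; rewrite uxx' ltxx.
  by have := exhaustive_mono lt x0; rewrite uxx' ltxx.
have tI : t \in `]-oo, (0:R)[%classic by rewrite inE /= in_itv.
have -> : 'pinv_(fun=> 0) `]-oo, 0[%classic u (- ln (normc w ^+ 2)) = t.
  by rewrite -/(logsq w) -ut pinvKV.
by rewrite oppr_gt0 opprK.
Qed.

Lemma psi0 : psi u 0 = 0.
Proof. by rewrite /psi eqxx. Qed.

Lemma psi_ge0 (w : Cplx R) : normc w < 1 -> 0 <= psi u w.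
Proof.
move=> w1; have [->|w0] := eqVneq w 0; first by rewrite psi0.
by apply/ltW; case: (@psiP w) => //; rewrite normc_gt0 w0.
Qed.

Lemma psi_lt (w : Cplx R) (t : R) : 0 < normc w < 1 -> t < 0 ->
  (t < - psi u w) = (u t < - logsq w).
Proof.
move=> w01 t0; have [p0 up] := psiP w01.
by rewrite -up exhaustive_mono_iff// oppr_lt0.
Qed.

Lemma psi_gt (w : Cplx R) (t : R) : 0 < normc w < 1 -> t < 0 ->
  (- psi u w < t) = (- logsq w < u t).
Proof.
move=> w01 t0; have [p0 up] := psiP w01.
by rewrite -up exhaustive_mono_iff// oppr_lt0.
Qed.

(** Solving the supporting line of u of slope k at - psi(w0) for the argument
gives a support of slope 1 / k. *)
Lemma psi_log_supported : log_supported (psi u).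
Proof.
split; [exact: psi0|exact: psi_ge0|].
move=> w0 w01; have [p0 up0] := psiP w01.
have t00 : - psi u w0 < 0 by rewrite oppr_lt0.
have [k k0 hk] := exhaustive_support t00.
exists k^-1; first by rewrite invr_gt0.
move=> w w1; have [p up] := psiP w1.
have := hk (- psi u w) ltac:(by rewrite oppr_lt0); rewrite up up0 => h.
rewrite -lerBrDl mulrC ler_pdivrMr//; lra.
Qed.

(** Away from 0, the bounds - psi(w) - e < - psi(y) < - psi(w) + e are by
monotonicity of u strict inequalities on log |y|^2, which hold near w. At 0
one bound suffices. *)
Lemma psi_continuous (w : Cplx R) : normc w < 1 -> contC (psi u) w.
Proof.
move=> w1; have [->|w0] := eqVneq w 0.
  move=> e e0; have ue : 0 < u (- e) by apply: exhaustive_gt0; rewrite oppr_lt0.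
  pose d := Num.min 1 (expR (- u (- e) / 2)).
  exists d; first by rewrite lt_min ltr01 expR_gt0.
  move=> y; rewrite subr0 psi0 subr0 lt_min => /andP[y1 yd].
  rewrite ger0_norm ?psi_ge0//.
  have [->|y0] := eqVneq y 0; first by rewrite psi0.
  have y01 : 0 < normc y < 1 by rewrite normc_gt0 y0.
  rewrite -ltrN2 psi_lt// ?oppr_lt0// ltrNr /logsq.
  have -> : - u (- e) = ln (expR (- u (- e) / 2) ^+ 2).
    by rewrite lnXn ?expR_gt0// expRK -mulr_natl; field.
  by rewrite ltr_ln ?posrE ?exprn_gt0 ?expR_gt0 ?normc_gt0// ltr_pXn2r ?nnegrE ?normc_ge0 ?expR_ge0.
have w01 : 0 < normc w < 1 by rewrite normc_gt0 w0.
have [p0 up] := psiP w01 => e e0.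
pose e1 := Num.min e (psi u w / 2).
have e10 : 0 < e1 by rewrite lt_min e0 divr_gt0.
have e1p : e1 < psi u w.
  by rewrite gt_min ltr_pdivrMr// ltr_pMr// ltr1n orbT.
have t1 : - psi u w - e1 < 0 by lra.
have t2 : - psi u w + e1 < 0 by lra.
have l1 : u (- psi u w - e1) < - logsq w by rewrite -psi_lt//; lra.
have l2 : - logsq w < u (- psi u w + e1) by rewrite -psi_gt//; lra.
pose m := Num.min (- logsq w - u (- psi u w - e1)) (u (- psi u w + e1) + logsq w).
have m0 : 0 < m by rewrite lt_min; apply/andP; split; lra.
have [d1 d10 hd1] := contC_logsq w0 m0.
have [d2 d20 hd2] := disc_punctured_nbhs w01.
exists (Num.min d1 d2); first by rewrite lt_min d10.
move=> y; rewrite lt_min => /andP[/hd1 y1 /hd2 y01].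
move: y1; rewrite lt_min => /andP[]; rewrite !ltr_norml => /andP[h1 h2] /andP[h3 h4].
have g1 : - psi u w - e1 < - psi u y by rewrite psi_lt//; lra.
have g2 : - psi u y < - psi u w + e1 by rewrite psi_gt//; lra.
have ee : e1 <= e by rewrite ge_min lexx.
by apply/andP; split; lra.
Qed.

(** For nonzero z and w both sides say that u (log |z|^2) < - log |w|^2; for z
= 0 or w = 0 both sides hold. *)
Lemma weight_psi_dual (z w : Cplx R) : normc z < 1 -> normc w < 1 ->
  (normc w ^+ 2 < expR (- phi z)) = (normc z ^+ 2 < expR (- psi u w)).
Proof.
move=> z1 w1; have sq1 (v : Cplx R) : normc v < 1 -> normc v ^+ 2 < 1.
  by move=> v1; rewrite exprn_ilt1// normc_ge0.
have [->|z0] := eqVneq z 0.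
  rewrite normc0 expr0n /= expR_gt0; have [_ _ -> _ _] := hw.
  by rewrite oppr0 expR0 sq1.
have [->|w0] := eqVneq w 0.
  by rewrite normc0 expr0n /= expR_gt0 psi0 oppr0 expR0 sq1.
have z01 : 0 < normc z < 1 by rewrite normc_gt0 z0.
have w01 : 0 < normc w < 1 by rewrite normc_gt0 w0.
have lg (v : Cplx R) (r : R) : 0 < normc v -> (normc v ^+ 2 < expR r) = (logsq v < r).
  by move=> v0; rewrite -[in RHS](expRK r) /logsq ltr_ln ?posrE ?exprn_gt0 ?expR_gt0.
rewrite !lg ?normc_gt0// psi_lt ?logsq_lt0// (weightE hw z01).
by rewrite ltrNr.
Qed.

Lemma area_psi :
  (area_int (unit_disc R) (fun z => expR (- phi z)) =
   area_int (unit_disc R) (fun w => expR (- psi u w)))%E.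
Proof.
rewrite !area_intE.
have me (g : Cplx R -> R) : (forall z, normc z < 1 -> contC g z) ->
    measurable_fun (plane_disc (1 : R)) (fun p => expR (- g (cpl p))).
  move=> cg; apply: (measurableT_comp (@measurable_expR R)); apply: measurable_funN.
  exact: contC_measurable.
apply: (@area_exchange R (fun p => expR (- phi (cpl p))) (fun q => expR (- psi u (cpl q)))).
- by apply: me => z; exact: (weight_continuous hw).
- by apply: me => z; exact: psi_continuous.
- move=> p; rewrite -unit_disc_cpl => p1.
  by rewrite expR_ge0 -[X in _ <= X](@expR0 R) ler_expR oppr_le0 (radial_weight_ge0_disc hw).
- move=> p; rewrite -unit_disc_cpl => p1.
  by rewrite expR_ge0 -[X in _ <= X](@expR0 R) ler_expR oppr_le0 psi_ge0.
move=> p q; rewrite -!unit_disc_cpl -!normc_sq_cpl => p1 q1.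
exact: weight_psi_dual.
Qed.

End exhaustive.

(** * Sub-mean value inequalities *)

Definition angles (R : realType) : set R := `[0, 2 * pi]%classic.
Arguments angles R : clear implicits.

Lemma measurable_angles (R : realType) : measurable (angles R : set (measurableTypeR R)).
Proof. exact: measurable_itv. Qed.

Lemma angles_measure (R : realType) :
  @lebesgue_measure R (angles R) = (2 * pi)%:E.
Proof.
by rewrite lebesgue_measure_itv/= lte_fin mulr_gt0 ?pi_gt0// -EFinB subr0.
Qed.

Lemma integrable_angles_cst (R : realType) (c : R) :
  (@lebesgue_measure R).-integrable (angles R) (fun=> c%:E) /\
  (\int[@lebesgue_measure R]_(t in angles R) c%:E = (c * (2 * pi))%:E)%E.
Proof.
have mI := @measurable_angles R.
split; last by rewrite integral_cst// -/(angles R); rewrite [X in (_ * X)%E]angles_measure.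
by apply: (@continuous_integrable_itv R 0 (2 * pi) (fun=> c)) => x; exact: cvg_cst.
Qed.

Lemma log_sq0 (R : realType) : log_sq (0 : Cplx R) = -oo%E.
Proof. by rewrite /log_sq normc0 expr0n le0_lneNy. Qed.

Lemma log_sq_ltE (R : realType) (z : Cplx R) (c : R) :
  (log_sq z < c%:E)%E = (normc z ^+ 2 < expR c).
Proof.
have [->|z0] := eqVneq z 0.
  by rewrite log_sq0 normc0 expr0n ltNyr expR_gt0.
rewrite /log_sq.
have n0 : 0 < normc z ^+ 2 by rewrite exprn_gt0// normc_gt0.
by rewrite lne_EFin// lte_fin -{1}(expRK c) ltr_ln ?posrE ?expR_gt0.
Qed.

Lemma log_sq_neq0 (R : realType) (z : Cplx R) : z != 0 -> log_sq z = (logsq z)%:E.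
Proof.
by move=> z0; rewrite /log_sq lne_EFin// exprn_gt0// normc_gt0.
Qed.

(** The point al + be e^(it) is al (1 + (be / al) e^(it)). *)
Lemma normc_sq_circle (R : realType) (al be : Cplx R) (t : R) : al != 0 ->
  normc (al + be * cis t) ^+ 2 = normc al ^+ 2 *
    trig (1 + normc (be / al) ^+ 2) (2 * complex.Re (be / al))
         (- 2 * complex.Im (be / al)) 1 t.
Proof.
move=> al0; have -> : al + be * cis t = al * (1 + be / al * cis t).
  by rewrite mulrDr mulr1 mulrA mulrCA divff// mulr1.
rewrite normcM exprMn; congr (_ * _).
case: (be / al) => x y; rewrite /trig /cis /= !sqr_sqrtr ?addr_ge0 ?sqr_ge0//.
rewrite mul1r; have := cos2Dsin2 t; set C := cos t; set S := sin t => h.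
transitivity (1 + (x ^+ 2 + y ^+ 2) * (C ^+ 2 + S ^+ 2) + 2 * x * C - 2 * y * S); first ring.
by rewrite h; ring.
Qed.

(** The sub-mean value inequality for log |z|^2 at al. The origin may lie
inside or on the circle, so that the integrand may take the value -oo. *)
Lemma log_sq_circle (R : realType) (al be : Cplx R) : al != 0 ->
  (@lebesgue_measure R).-integrable (angles R) (fun t => log_sq (al + be * cis t)) /\
  ((logsq al * (2 * pi))%:E <=
     \int[@lebesgue_measure R]_(t in angles R) log_sq (al + be * cis t)%R)%E.
Proof.
move=> al0; set ga := be / al; pose B := 2 * normc ga.
have B0 : 0 <= B by rewrite mulr_ge0// normc_ge0.
have abB : (2 * complex.Re ga) ^+ 2 + (- 2 * complex.Im ga) ^+ 2 = B ^+ 2.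
  rewrite /B; move: (ga) => [x y] /=; rewrite [in RHS]exprMn sqr_sqrtr ?addr_ge0 ?sqr_ge0//; ring.
have AB : 1 + B ^+ 2 / 4 <= 1 + normc ga ^+ 2.
  by rewrite /B le_eqVlt; apply/orP; left; apply/eqP; field.
have [ih h0] := integral_lne_trig B0 abB AB.
have [ic Ec] := integrable_angles_cst (logsq al).
have n0 : 0 < normc al ^+ 2 by rewrite exprn_gt0// normc_gt0.
have E t : log_sq (al + be * cis t) = ((logsq al)%:E +
    lne (trig (1 + normc ga ^+ 2) (2 * complex.Re ga) (- 2 * complex.Im ga) 1 t)%:E)%E.
  rewrite /log_sq normc_sq_circle// -/ga; set T := trig _ _ _ _ _.
  have [T0|T0] := ltP 0 T.
    have nT : 0 < normc al ^+ 2 * T by exact: mulr_gt0.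
    by rewrite (lne_EFin T0) (lne_EFin nT) -EFinD /logsq -lnM ?posrE.
  by rewrite !le0_lneNy ?lee_fin//; rewrite mulr_ge0_le0// ltW.
under eq_fun do rewrite E.
have mI := @measurable_angles R.
split; first exact: (integrableD mI ic ih).
rewrite (integralD mI ic ih) Ec -[leLHS]adde0; exact: leeD.
Qed.

(** The minorant is the support of g at w, as a function on the circle; for w
= 0 it is 0. When the circle passes through 0 the support takes the value -oo
there, since its slope is positive. *)
Lemma log_supported_minorant (R : realType) (g : Cplx R -> R) (w be : Cplx R) :
  log_supported g -> (forall t, normc (w + be * cis t) < 1) -> normc w < 1 ->
  exists l : R -> \bar R,
  [/\ (@lebesgue_measure R).-integrable (angles R) l,
      (forall t, l t <= (g (w + be * cis t))%:E)%E &
      ((g w * (2 * pi))%:E <= \int[@lebesgue_measure R]_(t in angles R) l t)%E].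
Proof.
move=> [g0 gp gs] wt w1; have [w0|w0] := eqVneq w 0.
  exists (fun=> 0%E); split => //.
  - exact: (integrable_angles_cst 0).1.
  - by move=> t; rewrite lee_fin gp.
  - by rewrite w0 g0 mul0r integral0.
have w01 : 0 < normc w < 1 by rewrite normc_gt0 w0.
have [k k0 hk] := gs w w01.
have [il El] := log_sq_circle be w0.
have [ic Ec] := integrable_angles_cst (g w - k * logsq w).
have mI := @measurable_angles R.
have ik := integrableZl mI k il.
exists (fun t => ((g w - k * logsq w)%:E + k%:E * log_sq (w + be * cis t)%R)%E); split.
- exact: (integrableD mI ic ik).
- move=> t; have [e|n0] := eqVneq (w + be * cis t) 0.
    by rewrite e log_sq0 gt0_muleNy ?lte_fin// addeNy leNye.
  rewrite log_sq_neq0// -EFinM -EFinD lee_fin.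
  have := hk (w + be * cis t); rewrite normc_gt0 n0 wt => /(_ isT); lra.
- rewrite (integralD mI ic ik) Ec integralZl//.
  have := lee_wpmul2l (_ : (0 <= k%:E)%E) El; rewrite lee_fin (ltW k0) => /(_ isT).
  move=> /(leeD2l (((g w - k * logsq w) * (2 * pi))%:E)); apply: le_trans.
  rewrite -EFinM -EFinD lee_fin le_eqVlt; apply/orP; left; apply/eqP; ring.
Qed.

Lemma circle_lipschitz (R : realType) (w be : Cplx R) (s t : R) :
  normc ((w + be * cis t) - (w + be * cis s)) <= 2 * normc be * `|t - s|.
Proof.
have -> : (w + be * cis t) - (w + be * cis s) = be * (cis t - cis s) by ring.
by rewrite normcM -mulrA mulrCA ler_wpM2l ?normc_ge0// cis_lipschitz.
Qed.

Lemma contC_circle (R : realType) (g : Cplx R -> R) (w be : Cplx R) :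
  (forall t, contC g (w + be * cis t)) -> continuous (fun t => g (w + be * cis t)).
Proof.
move=> cg t; apply/cvgrPdist_lt => e e0; have [d d0 hd] := cg t e e0.
pose K := 2 * normc be + 1.
have K0 : 0 < K by rewrite ltr_wpDl// mulr_ge0// normc_ge0.
have dK : 0 < d / K by rewrite divr_gt0.
apply: filterS (nbhsx_ballx t _ dK) => s; rewrite /ball /= => ts.
rewrite distrC; apply: hd; apply: le_lt_trans (circle_lipschitz _ _ _ _) _.
rewrite distrC; apply: (@le_lt_trans _ _ (K * `|t - s|)).
  by rewrite ler_wpM2r// lerDl.
by rewrite mulrC -ltr_pdivlMr.
Qed.

Lemma contC_circle_measurable (R : realType) (g : Cplx R -> R) (w be : Cplx R) :
  (forall t, contC g (w + be * cis t)) ->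
  measurable_fun (angles R) (fun t => g (w + be * cis t)).
Proof.
move=> cg; apply: (measurable_funS measurableT) => //.
by apply: continuous_measurable_fun; exact: contC_circle.
Qed.

Lemma contC_normc_sq (R : realType) (z : Cplx R) : contC (fun y => normc y ^+ 2) z.
Proof.
apply: (contC_comp (v := fun x => x ^+ 2) (@contC_normc R z)).
exact: exprn_continuous.
Qed.

Lemma log_sq_circle_measurable (R : realType) (z be : Cplx R) :
  measurable_fun (angles R) (fun t => log_sq (z + be * cis t)).
Proof.
apply: measurable_lne_comp; first exact: measurable_itv.
apply: (contC_circle_measurable (g := fun y => normc y ^+ 2)) => t.
exact: contC_normc_sq.
Qed.

Lemma submean_div (R : realType) (x i : \bar R) :
  (x * (2 * pi)%:E <= i)%E -> (x <= ((2 * pi)^-1)%:E * i)%E.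
Proof.
have p0 : 0 < 2 * pi :> R by rewrite mulr_gt0 ?pi_gt0.
move=> h; have := @lee_wpmul2l R ((2 * pi)^-1)%:E.
rewrite lee_fin invr_ge0 (ltW p0) => /(_ isT _ _ h).
by rewrite muleCA -EFinM mulVf ?gt_eqF// mule1.
Qed.

Lemma log_supported_submean (R : realType) (g : Cplx R -> R) (w be : Cplx R) :
  log_supported g -> (forall z, normc z < 1 -> contC g z) ->
  (forall t, normc (w + be * cis t) < 1) -> normc w < 1 ->
  ((g w)%:E <= ((2 * pi)^-1)%:E *
    \int[@lebesgue_measure R]_(t in angles R) (g (w + be * cis t)%R)%:E)%E.
Proof.
move=> lg cg wt w1; have [l [il lle hl]] := log_supported_minorant lg wt w1.
apply: submean_div; rewrite -EFinM; apply: le_trans hl _.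
apply: le_integral_minorant => //; first exact: measurable_itv.
by apply/measurable_EFinP; apply: contC_circle_measurable => t; exact: cg.
Qed.

(** At z = 0 the left-hand side is -oo. Otherwise the sum of the two minorants
is integrable. *)
Lemma log_sum_submean (R : realType) (g : Cplx R -> R) (z al w be : Cplx R) :
  log_supported g -> (forall z, normc z < 1 -> contC g z) ->
  (forall t, normc (w + be * cis t) < 1) -> normc w < 1 ->
  (log_sq z + (g w)%:E <= ((2 * pi)^-1)%:E *
    \int[@lebesgue_measure R]_(t in angles R)
      (log_sq (z + al * cis t)%R + (g (w + be * cis t)%R)%:E))%E.
Proof.
move=> lg cg wt w1; have [->|z0] := eqVneq z 0.
  by rewrite log_sq0 addNye leNye.
have [l [il lle hl]] := log_supported_minorant lg wt w1.
have [iz hz] := log_sq_circle al z0.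
have mI := @measurable_angles R.
apply: submean_div; rewrite log_sq_neq0// -EFinD -EFinM mulrDl EFinD.
apply: (le_trans (leeD hz hl)); rewrite -(integralD mI iz il).
apply: le_integral_minorant => //; first exact: (integrableD mI iz il).
- apply: emeasurable_funD; first exact: log_sq_circle_measurable.
  by apply/measurable_EFinP; apply: contC_circle_measurable => t; exact: cg.
- by move=> t _; exact: leeD2l.
Qed.

(** * Subharmonicity and plurisubharmonicity *)

Lemma open_unit_disc (R : realType) : open (unit_disc R).
Proof.
rewrite openE => z z1; apply/nearC; have d0 : 0 < 1 - normc z.
  by rewrite subr_gt0.
exists (1 - normc z) => // y; rewrite ltrBrDr => h.
change (normc y < 1); apply: le_lt_trans h.
by rewrite -{1}(subrK z y) le_normcD.
Qed.

Lemma circle_in_disc (R : realType) (D : set (Cplx R)) (a : Cplx R) (r t : R) :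
  0 < r -> (forall z : Cplx R, normc (z - a) <= r -> D z) ->
  D (a + r%:C%C * cis t) /\ D a.
Proof.
move=> r0 h; split; apply: h; last by rewrite subrr normc0 ltW.
by rewrite addrC addKr normc_radius// ltW.
Qed.

(** Upper semicontinuity from continuity, and the sub-mean value inequality
from the minorant. *)
Lemma log_supported_subharmonic (R : realType) (g : Cplx R -> R) :
  log_supported g -> (forall z, normc z < 1 -> contC g z) ->
  subharmonic (unit_disc R) (EFin \o g).
Proof.
move=> lg cg; split; first exact: open_unit_disc.
  move=> z z1; split; first exact: ltry.
  move=> c; rewrite /= lte_fin => gc; apply/nearC.
  have gc0 : 0 < c - g z by rewrite subr_gt0.
  have [d d0 hd] := cg z z1 _ gc0; exists d => // y /hd.
  by rewrite lte_fin ltr_norml => /andP[_]; rewrite ltrD2r.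
move=> a r r0 h; apply: log_supported_submean => //.
  by move=> t; exact: (circle_in_disc t r0 h).1.
exact: (circle_in_disc 0 r0 h).2.
Qed.

Section plurisubharmonic.
Context {R : realType} (phi : Cplx R -> R) (u : R -> R).
Context (he : exhaustive_weight phi u).

Let hw : radial_weight phi u. Proof. by case: he. Qed.

(** The weight is nonnegative, so that the second component is also in the
disc. *)
Lemma tDelta_disc (p : Cplx R * Cplx R) : tDelta phi p ->
  normc p.1 < 1 /\ normc p.2 < 1.
Proof.
move=> [p1 p2]; split=> //; have : normc p.2 ^+ 2 < 1.
  apply: lt_le_trans p2 _.
  by rewrite -[leRHS](@expR0 R) ler_expR oppr_le0 (radial_weight_ge0_disc hw).
by rewrite expr_lt1// normc_ge0.
Qed.

Lemma open_tDelta : open (tDelta phi).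
Proof.
rewrite openE => p hp; have [p1 p2] := tDelta_disc hp.
have c1 : phi q.1 @[q --> p] --> phi p.1.
  by apply: (@continuous_comp _ _ _ fst phi p); [exact: cvg_fst|apply/contCP; exact: (weight_continuous hw)].
have c2 : normc q.2 ^+ 2 @[q --> p] --> normc p.2 ^+ 2.
  by apply: (@continuous_comp _ (Cplx R) R snd (fun z => normc z ^+ 2) p); [exact: cvg_snd|apply/contCP; exact: contC_normc_sq].
have c : expR (- phi q.1) - normc q.2 ^+ 2 @[q --> p] --> expR (- phi p.1) - normc p.2 ^+ 2.
  apply: cvgB => //; apply: continuous_cvg; [exact: continuous_expR|exact: cvgN].
have h1 : \forall q \near p, unit_disc R q.1.
  have h0 : nbhs p.1 (unit_disc R).
    by apply: open_nbhs_nbhs; split; [exact: open_unit_disc|exact: p1].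
  exact: (@cvg_fst _ _ (nbhs p.1) (nbhs p.2) _ _ h0).
have h2 : \forall q \near p, 0 < expR (- phi q.1) - normc q.2 ^+ 2.
  by move/cvgr_gt : c; apply; rewrite subr_gt0; case: hp.
by apply: filterS2 h1 h2 => q q1; rewrite subr_gt0.
Qed.

(** This form shows upper semicontinuity at z = 0 and elsewhere at once: the
right-hand side compares two continuous functions. *)
Lemma tG_ltE (p : Cplx R * Cplx R) (c : R) :
  (tG u p < c%:E)%E = (normc p.1 ^+ 2 < expR (c - psi u p.2)).
Proof. by rewrite /tG -lteBrDr// -EFinB log_sq_ltE. Qed.

(** Negativity of the function is the dual description of the domain. *)
Lemma tG_lt0 (p : Cplx R * Cplx R) : tDelta phi p -> (tG u p < 0)%E.
Proof.
move=> hp; have [p1 p2] := tDelta_disc hp.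
by rewrite tG_ltE sub0r -(weight_psi_dual he)//; case: hp.
Qed.

Lemma tG_usc : usc_on (tDelta phi) (tG u).
Proof.
move=> p hp; split; first exact: lt_trans (tG_lt0 hp) (ltry 0).
have [p1 p2] := tDelta_disc hp.
move=> c; rewrite tG_ltE => gc.
have c1 : normc q.1 ^+ 2 @[q --> p] --> normc p.1 ^+ 2.
  by apply: (@continuous_comp _ (Cplx R) R fst (fun z => normc z ^+ 2) p); [exact: cvg_fst|apply/contCP; exact: contC_normc_sq].
have c2 : psi u q.2 @[q --> p] --> psi u p.2.
  by apply: (@continuous_comp _ _ _ snd (psi u) p); [exact: cvg_snd|apply/contCP; exact: (psi_continuous he)].
have cc : expR (c - psi u q.2) - normc q.1 ^+ 2 @[q --> p] --> expR (c - psi u p.2) - normc p.1 ^+ 2.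
  apply: cvgB => //; apply: continuous_cvg; [exact: continuous_expR|apply: cvgB => //; exact: cvg_cst].
have : \forall q \near p, 0 < expR (c - psi u q.2) - normc q.1 ^+ 2.
  by move/cvgr_gt : cc; apply; rewrite subr_gt0.
by apply: filterS => q; rewrite subr_gt0 tG_ltE.
Qed.

Lemma slice_continuous (a b : Cplx R * Cplx R) :
  continuous (fun s : Cplx R => a + s *: b).
Proof.
move=> s; apply: (@cvgD _ _ _ (nbhs s) _ (cst a) ( *:%R^~ b)).
  exact: cvg_cst.
exact: scalel_continuous.
Qed.

(** A circle in the parameter of the line a + s b is sent to a circle in each
component, of radii |r b.1| and |r b.2|, which may be 0. *)
Lemma tG_plurisubharmonic : plurisubharmonic (tDelta phi) (tG u).
Proof.
split; [exact: open_tDelta|exact: tG_usc|] => a b; split.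
- apply: (@open_comp _ _ (fun s : Cplx R => a + s *: b)); last exact: open_tDelta.
  by move=> s _; exact: slice_continuous.
- move=> s hs; have [h1 h2] := tG_usc hs; split => // c gc.
  exact: (slice_continuous (h2 c gc)).
move=> s r r0 h; rewrite /circle_int.
have E t : a + (s + r%:C%C * cis t) *: b =
    ((a.1 + s * b.1) + (r%:C%C * b.1) * cis t, (a.2 + s * b.2) + (r%:C%C * b.2) * cis t).
  by case: a b {h} => a1 a2 [b1 b2]; congr pair; rewrite /= /GRing.scale /=; ring.
have hD t := circle_in_disc t r0 h.
apply: le_trans (@log_sum_submean _ (psi u) (a.1 + s * b.1) (r%:C%C * b.1)
  (a.2 + s * b.2) (r%:C%C * b.2) _ _ _ _) _.
- exact: psi_log_supported he.
- by move=> z; exact: (psi_continuous he).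
- move=> t; have [/tDelta_disc[_ +] _] := hD t; by rewrite E.
- by have [_ /tDelta_disc[_ +]] := hD 0.
rewrite le_eqVlt; apply/orP; left; apply/eqP; congr (_ * _)%E.
by apply: eq_integral => t _; rewrite -/(cis t) E.
Qed.

End plurisubharmonic.

(** * The regularized weights *)

Section regularized.
Context {R : realType} (phi : Cplx R -> R) (u : R -> R) (e : R).
Context (hw : radial_weight phi u) (e0 : 0 < e).

Lemma u_epsE (t : R) : u_eps u e t = u t + e * exp_convex t.
Proof. by rewrite /u_eps /exp_convex mulrN. Qed.

Lemma phi_epsE (z : Cplx R) : 0 < normc z < 1 ->
  phi_eps phi e z = u_eps u e (logsq z).
Proof.
move=> z01; rewrite /phi_eps /u_eps (weightE hw z01) /logsq lnK//.
by rewrite posrE exprn_gt0//; case/andP: z01.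
Qed.

Lemma phi_eps0 : phi_eps phi e 0 = 0.
Proof.
by have [_ _ p0 _ _] := hw; rewrite /phi_eps p0 normc0 expr0n subr0 ln1 mulr0 subr0.
Qed.

(** The slopes add up, and that of the second summand is positive. *)
Lemma u_eps_support (t0 : R) : t0 < 0 -> exists2 k : R, 0 < k &
  forall t, t < 0 -> u_eps u e t0 + k * (t - t0) <= u_eps u e t.
Proof.
move=> t00; have [_ /(_ t0 t00)[k k0 hk]] := radial_weight_profile hw.
have s0 := exp_convex_slope_gt0 t00; set s := _ / _ in s0.
exists (k + e * s); first by rewrite ltr_wpDl// mulr_gt0.
move=> t tl0; rewrite !u_epsE; have := hk t tl0.
have := ler_wpM2l (ltW e0) (exp_convex_support t00 tl0); rewrite -/s.
by move: (exp_convex t0) (exp_convex t) => x y; lra.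
Qed.

Lemma u_eps_convex : @convex_function R R^o `]-oo, 0[%classic (u_eps u e).
Proof.
apply: mix_convex_function => x y l; apply: support_mix => t0 /u_eps_support[k k0 hk].
by exists k => //; exact: ltW.
Qed.

Lemma u_eps_lt (s t : R) : s < t -> t < 0 -> u_eps u e s < u_eps u e t.
Proof.
move=> st t0; have [mu _] := radial_weight_profile hw.
rewrite !u_epsE; apply: ler_ltD; first exact: mu (ltW st) t0.
by rewrite ltr_pM2l// exp_convex_lt.
Qed.

Lemma u_eps_pinfty : u_eps u e t @[t --> 0^'-] --> +oo.
Proof.
apply/cvgryPge => A; have /cvgryPge/(_ (A / e)) h := @exp_convex_pinfty R.
near=> t; have t0 : t < 0 by near: t; exact: nbhs_left_lt.
rewrite u_epsE; apply: (@le_trans _ _ (e * exp_convex t)).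
  by rewrite mulrC -ler_pdivrMr//; near: t.
by rewrite lerDr (radial_weight_ge0 hw).
Unshelve. all: by end_near. Qed.

Lemma phi_eps_ge (z : Cplx R) : normc z < 1 -> phi z <= phi_eps phi e z.
Proof.
move=> z1; rewrite /phi_eps lerBrDr gerDl mulr_ge0_le0 ?(ltW e0)//.
by apply: ln_le0; rewrite gerBl exprn_ge0// normc_ge0.
Qed.

Lemma phi_eps_log_supported : log_supported (phi_eps phi e).
Proof.
split; first exact: phi_eps0.
- by move=> z z1; apply: le_trans (phi_eps_ge z1); exact: (radial_weight_ge0_disc hw).
move=> z0 z01; have [k k0 hk] := u_eps_support (logsq_lt0 z01).
by exists k => // z z1; rewrite !phi_epsE//; apply: hk; exact: logsq_lt0.
Qed.

Lemma sq_lt1 (z : Cplx R) : normc z < 1 -> 0 < 1 - normc z ^+ 2.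
Proof. by move=> z1; rewrite subr_gt0 expr_lt1// normc_ge0. Qed.

Lemma phi_eps_continuous (z : Cplx R) : normc z < 1 -> contC (phi_eps phi e) z.
Proof.
move=> z1; apply/contCP; have p0 := sq_lt1 z1.
have c2 : {for z, continuous (fun y : Cplx R => ln (1 - normc y ^+ 2))}.
  apply/contCP; apply: (contC_comp (v := fun x => ln (1 - x)) (@contC_normc_sq R z)).
  apply: (@continuous_comp _ _ _ (fun x : R => 1 - x) (@ln R)).
    by apply: cvgB; [exact: cvg_cst|exact: cvg_id].
  exact: continuous_ln.
have c1 : {for z, continuous phi} by apply/contCP; exact: (weight_continuous hw).
apply: (@cvgB _ _ _ (nbhs z) _ phi) => //.
apply: (@cvgMr _ _ (nbhs z) _ _ e _ c2).
Qed.

Lemma phi_eps_exhaustive : exhaustive_weight (phi_eps phi e) (u_eps u e).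
Proof.
have [_ rad p0 _ _] := hw.
have mu : {in `]-oo, (0 : R)[ &, {homo u_eps u e : s t / s < t}}.
  by move=> s t _; rewrite in_itv/= => t0 st; exact: u_eps_lt.
split=> //; last exact: u_eps_pinfty.
split.
- by apply: log_supported_subharmonic; [exact: phi_eps_log_supported|exact: phi_eps_continuous].
- by move=> z w z1 w1 zw; rewrite /phi_eps (rad z w)// zw.
- exact: phi_eps0.
- split; first exact: u_eps_convex.
  by move=> s t s0 t0; rewrite le_eqVlt => /predU1P[->//|st]; exact/ltW/mu.
- by move=> z; exact: phi_epsE.
Qed.

End regularized.

(** Dominated convergence along sequences: exp(-phi_eps) is bounded by 1 and
converges pointwise. *)
Lemma area_phi_eps_cvg (R : realType) (phi : Cplx R -> R) (u : R -> R) :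
  radial_weight phi u ->
  area_int (unit_disc R) (fun z => expR (- phi_eps phi e z)) @[e --> 0^'+] -->
  area_int (unit_disc R) (fun z => expR (- phi z)).
Proof.
move=> hw; rewrite area_intE; under eq_fun do rewrite area_intE.
pose D : set (measurableTypeR R * measurableTypeR R)%type := plane_disc (1 : R).
have mD : measurable D by exact: measurable_plane_disc.
have me (g : Cplx R -> R) : (forall z, normc z < 1 -> contC g z) ->
    measurable_fun D (fun p : (measurableTypeR R * measurableTypeR R)%type => (expR (- g (cpl p)))%:E).
  move=> cg; apply/measurable_EFinP.
  apply: (measurableT_comp (@measurable_expR R)); apply: measurable_funN.
  exact: contC_measurable.
have ex1 (g : Cplx R -> R) p : 0 <= g (cpl p) -> `|expR (- g (cpl p))| <= 1.
  by move=> g0; rewrite ger0_norm ?expR_ge0// -[leRHS](@expR0 R) ler_expR oppr_le0.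
have /andP[_ Doo] : (0 < leb2 R D < +oo)%E := plane_disc_area_gt0_lty R.
suff dom (x : R^nat) : (forall n, 0 < x n) /\ x n @[n --> \oo] --> 0 ->
    (leb2 R).-integrable D (fun p => (expR (- phi (cpl p)))%:E) /\
    (\int[leb2 R]_(p in D) (expR (- phi_eps phi (x n) (cpl p)))%:E)%E @[n --> \oo] -->
    (\int[leb2 R]_(p in D) (expR (- phi (cpl p)))%:E)%E.
  (* The limit is finite by domination along one sequence. *)
  have [i _] := dom _ (conj (fun n => harmonic_gt0 n) (@cvg_harmonic R)).
  rewrite -(fineK (integrable_fin_num mD i)); apply/cvge_at_rightP => x hx.
  by rewrite (fineK (integrable_fin_num mD i)); exact: (dom x hx).2.
move=> [x0 cx].
have := @dominated_convergence _ _ _ (leb2 R) D mD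
  (fun n p => (expR (- phi_eps phi (x n) (cpl p)))%:E)
  (fun p => (expR (- phi (cpl p)))%:E) (cst 1%E).
have H1 n : measurable_fun D (fun p : (measurableTypeR R * measurableTypeR R)%type => (expR (- phi_eps phi (x n) (cpl p)))%:E).
  by apply: me => z z1; exact: (phi_eps_continuous _ hw).
have H2 : measurable_fun D (fun p : (measurableTypeR R * measurableTypeR R)%type => (expR (- phi (cpl p)))%:E).
  by apply: me => z; exact: (weight_continuous hw).
move=> /(_ H1 H2).
have H3 : {ae leb2 R, forall p, D p -> (expR (- phi_eps phi (x n) (cpl p)))%:E @[n --> \oo] --> (expR (- phi (cpl p)))%:E}.
  apply: aeW => p Dp; apply: cvg_EFin; first exact: nearW.
  apply: continuous_cvg; first exact: continuous_expR.
  apply: cvgN; rewrite -[X in _ --> X]subr0; apply: cvgB; first exact: cvg_cst.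
  by rewrite -(mul0r (ln (1 - normc (cpl p) ^+ 2))); apply: cvgM => //; exact: cvg_cst.
have H4 : (leb2 R).-integrable D (cst 1%E).
  apply/integrableP; split; first exact: measurable_cst.
  rewrite (eq_integral (cst 1%E)); last by move=> p _; rewrite /= normr1.
  by rewrite integral_cst// mul1e.
have H5 : {ae leb2 R, forall p n, D p -> (`|(expR (- phi_eps phi (x n) (cpl p)))%:E| <= cst 1 p)%E}.
  apply: aeW => p n Dp; rewrite lee_fin; apply: ex1.
  have p1 : normc (cpl p) < 1 by move: Dp; rewrite /D -unit_disc_cpl.
  exact: le_trans (radial_weight_ge0_disc hw p1) (phi_eps_ge phi (x0 n) p1).
by move=> /(_ H3 H4 H5)[h _ h']; split.
Qed.

(** * The least norm as an integral and as a limit *)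

Lemma min_wnorm2 (R : realType) (phi : Cplx R -> R) (u : R -> R) :
  radial_weight phi u ->
  [/\ extensions R (cst 1),
      wnorm2 phi (cst 1) = area_int (unit_disc R) (fun z => expR (- phi z)) &
      is_min (wnorm2 phi @` extensions R)
        (area_int (unit_disc R) (fun z => expR (- phi z)))].
Proof.
move=> hw; have ext1 : extensions R (cst 1).
  by split => // z _; exact: derivable_cst.
have norm1 : wnorm2 phi (cst 1) = area_int (unit_disc R) (fun z => expR (- phi z)).
  rewrite /wnorm2; congr area_int; apply/funext => z.
  by rewrite /cst normc1 expr1n mul1r.
split=> //; split; first by exists (cst 1).
move=> _ [f [hf f0] <-]; apply: min_norm_extension => //; first by case: hw.
exact: weight_measurable hw.
Qed.

Theorem mainTheorem3 (R : realType) (phi : Cplx R -> R) (u : R -> R)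
    (hphi : radial_weight phi u) :
  (* (a) *)
  (exhaustive_weight phi u ->
    [/\ plurisubharmonic (tDelta phi) (tG u) /\
          (forall p, tDelta phi p -> (tG u p < 0)%E),
        {within unit_disc R, continuous (psi u)},
        [/\ {within tDelta phi, continuous (tA u)},
            {within tDelta phi, continuous (tB u)} &
            forall p, tDelta phi p ->
              (tG u p <= log_sq p.1 + (tA u p)%:E)%E /\
              (log_sq p.1 - (tB u p)%:E <= tG u p)%E] &
        [/\ is_min (wnorm2 phi @` extensions R)
              (area_int (unit_disc R) (fun w => expR (tB u (0, w)))),
            extensions R (cst 1) &
            wnorm2 phi (cst 1) =
              area_int (unit_disc R) (fun w => expR (tB u (0, w)))]]) /\
  (* (b) *)
  [/\ forall e : R, 0 < e -> exhaustive_weight (phi_eps phi e) (u_eps u e),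
      area_int (unit_disc R) (fun w => expR (- psi (u_eps u e) w))
        @[e --> 0^'+] -->
        area_int (unit_disc R) (fun z => expR (- phi z)) &
      is_min (wnorm2 phi @` extensions R)
        (area_int (unit_disc R) (fun z => expR (- phi z)))].
Proof.
have [ext1 norm1 min1] := min_wnorm2 hphi; split.
  move=> he; have cpsi := psi_continuous he.
  have ctA : {within tDelta phi, continuous (tA u)}.
    apply: continuous_in_subspaceT => p /set_mem/(tDelta_disc he)[_ p2].
    apply: (@continuous_comp _ (Cplx R) R snd (psi u) p); first exact: cvg_snd.
    exact/contCP/cpsi.
  have EB : area_int (unit_disc R) (fun w => expR (tB u (0, w))) =
      area_int (unit_disc R) (fun z => expR (- phi z)).
    by rewrite (area_psi he).
  split.
  - split; first exact: (tG_plurisubharmonic he).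
    exact: (tG_lt0 he).
  - apply: continuous_in_subspaceT => w /set_mem w1; exact/contCP/cpsi.
  - split; [exact: ctA|by move=> p; apply: cvgN; exact: ctA|].
    by move=> p _; split; rewrite /tG /tA /tB ?EFinN ?oppeK.
  - by rewrite EB.
split=> //; first by move=> e e0; exact: phi_eps_exhaustive.
apply: cvg_trans (area_phi_eps_cvg hphi); apply: near_eq_cvg.
near=> e; have e0 : 0 < e by near: e; exact: nbhs_right_gt.
exact: (area_psi (phi_eps_exhaustive hphi e0)).
Unshelve. all: by end_near. Qed.
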